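(* Let $\mathbb{X}$ be a bounded subset of $\mathbb{R}^d$ (with the Euclidean distance). Then there exists a constant $C_d>0$ depending on $d$ and $\mathrm{diam}(\mathbb{X})$ but not on $n$, such that for every $\mathbb{Q}\in\mathcal{P}(\mathcal{P}(\mathbb{X}))$, at least for $n$ large enough, $$\mathbb{E}\big(d_{\mathrm{Lip}}(\tilde{\mathbb{Q}}_{(n)},\mathbb{Q})\big)\le\begin{cases}C_1\,n^{-1/2} & \text{if } d=1,\\ C_2\,n^{-1/2}\log(n) & \text{if } d=2,\\ C_d\,n^{-1/d} & \text{if } d>2.\end{cases}$$
   Context: Standing assumption: $\mathbb{X}$ with its metric is Polish (complete, separable metric space) of finite diameter $\mathrm{diam}(\mathbb{X})$. $\mathcal{P}(\mathbb{X})$ is the space of Borel probability measures on $\mathbb{X}$ with the weak topology, and $\mathcal{P}(\mathcal{P}(\mathbb{X}))$ the space of Borel probability measures on it. $P(f)=\int f\,\mathrm{d}P$ and $\mathcal{L}(\cdot)$ denotes the law. The Lipschitz HIPM is $d_{\mathrm{Lip}}(\mathbb{Q}_1,\mathbb{Q}_2)=\sup_f\mathcal{W}(\mathcal{L}(\tilde P_1(f)),\mathcal{L}(\tilde P_2(f)))$, where $\tilde P_i\sim\mathbb{Q}_i$, $f$ ranges over the 1-Lipschitz functions $\mathbb{X}\to\mathbb{R}$, and $\mathcal{W}$ is the Wasserstein distance of order 1 on $\mathbb{R}$ with the usual distance. Empirical estimator: given $\tilde P_1,\dots,\tilde P_n$ i.i.d. random probabilities with law $\mathbb{Q}$, $\tilde{\mathbb{Q}}_{(n)}=\frac1n\sum_{i=1}^n\delta_{\tilde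 P_i}$, a random element of $\mathcal{P}(\mathcal{P}(\mathbb{X}))$; $d_{\mathrm{Lip}}(\tilde{\mathbb{Q}}_{(n)},\mathbb{Q})$ is evaluated at each realization and $\mathbb{E}$ averages over realizations. *)

(* Defs.v *)
From HB Require Import structures.
From mathcomp Require Import all_boot all_order all_algebra.
From mathcomp Require Import all_classical all_reals all_analysis.
From mathcomp Require Import ring lra.

Set Implicit Arguments.
Unset Strict Implicit.
Unset Printing Implicit Defensive.

Import Order.TTheory GRing.Theory Num.Theory.
Import numFieldNormedType.Exports.

Local Open Scope classical_set_scope.
Local Open Scope ring_scope.

(* MathComp-Analysis measurable types carry a base point, so the spaces on
   which measures live are pointed here. *)
#[short(type="pmetricType")]
HB.structure Definition PointedMetric (K : numDomainType) :=
  {M of Pointed M & Metric K M}.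

Definition polish (R : realType) (T : pmetricType R) : Prop :=
  (forall F : set_system T, ProperFilter F -> cauchy F -> cvg F) /\
  (exists S : set T, countable S /\ dense S).

Definition metric_bounded (R : realType) (T : metricType R) (X : set T) : Prop :=
  exists M : R, forall x y, X x -> X y -> mdist x y <= M.

Definition diam (R : realType) (T : metricType R) (X : set T) : R :=
  sup [set r | exists x y, [/\ X x, X y & r = mdist x y]].

(* The row space R^d with the Euclidean distance; the library's own metric on
   'rV_d is the one of the sup norm. *)
Section euclidean.
Variables (R : realType) (d : nat).

Definition euclidean : Type := 'rV[R]_d.

HB.instance Definition _ := Choice.on euclidean.

Definition euclidean_dist (x y : euclidean) : R :=
  Num.sqrt (\sum_(i < d) (x ord0 i - y ord0 i) ^+ 2).

Let euclidean_distxx x : euclidean_dist x x = 0.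
Proof.
by rewrite /euclidean_dist big1 ?sqrtr0// => i _; rewrite subrr expr0n.
Qed.

Let euclidean_dist_positivity x y : euclidean_dist x y = 0 -> x = y.
Proof.
move=> /eqP; rewrite sqrtr_eq0 => s0; apply/rowP => i; apply/eqP.
rewrite -subr_eq0 -sqrf_eq0; apply/eqP.
have ge0 (j : 'I_d) : true -> 0 <= (x ord0 j - y ord0 j) ^+ 2.
  by move=> _; exact: sqr_ge0.
have /eqP : \sum_(j < d) (x ord0 j - y ord0 j) ^+ 2 = 0.
  by apply/eqP; rewrite eq_le s0 sumr_ge0.
by rewrite psumr_eq0// => /allP/(_ i (mem_index_enum _))/= /eqP.
Qed.

Let euclidean_dist_sym x y : euclidean_dist x y = euclidean_dist y x.
Proof.
by rewrite /euclidean_dist; congr Num.sqrt; apply: eq_bigr => i _;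
  rewrite -sqrrN opprB.
Qed.

Let cauchy_schwarz (a b : 'I_d -> R) :
  (\sum_i a i * b i) ^+ 2 <= (\sum_i a i ^+ 2) * (\sum_i b i ^+ 2).
Proof.
have : 0 <= \sum_i \sum_j (a i * b j - a j * b i) ^+ 2.
  by apply: sumr_ge0 => i _; apply: sumr_ge0 => j _; exact: sqr_ge0.
have -> : \sum_i \sum_j (a i * b j - a j * b i) ^+ 2 =
    ((\sum_i a i ^+ 2) * (\sum_i b i ^+ 2) - (\sum_i a i * b i) ^+ 2) *+ 2.
  have e1 : (\sum_i a i ^+ 2) * (\sum_i b i ^+ 2) =
      \sum_i \sum_j a i ^+ 2 * b j ^+ 2 by rewrite big_distrlr.
  have e2 : (\sum_i a i ^+ 2) * (\sum_i b i ^+ 2) =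
      \sum_i \sum_j a j ^+ 2 * b i ^+ 2 by rewrite e1 exchange_big.
  have e3 : (\sum_i a i * b i) ^+ 2 =
      \sum_i \sum_j (a i * b i) * (a j * b j) by rewrite expr2 big_distrlr.
  rewrite mulr2n {1}e1 e2 e3 -!sumrB -big_split/=; apply: eq_bigr => i _.
  rewrite -!sumrB -big_split/=; apply: eq_bigr => j _; ring.
by rewrite pmulrn_lge0// subr_ge0.
Qed.

Let euclidean_dist_triangle y x z :
  euclidean_dist x z <= euclidean_dist x y + euclidean_dist y z.
Proof.
rewrite /euclidean_dist; set A := \sum_i (x ord0 i - y ord0 i) ^+ 2.
set B := \sum_i (y ord0 i - z ord0 i) ^+ 2.
have A0 : 0 <= A by apply: sumr_ge0 => i _; exact: sqr_ge0.
have B0 : 0 <= B by apply: sumr_ge0 => i _; exact: sqr_ge0.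
rewrite -(@ler_pXn2r _ 2)// ?nnegrE ?addr_ge0 ?sqrtr_ge0//.
rewrite sqrrD !sqr_sqrtr//; last by apply: sumr_ge0 => i _; exact: sqr_ge0.
have -> : \sum_i (x ord0 i - z ord0 i) ^+ 2 = A + (\sum_i
    (x ord0 i - y ord0 i) * (y ord0 i - z ord0 i)) *+ 2 + B.
  rewrite -sumrMnl -!big_split/=; apply: eq_bigr => i _; ring.
rewrite lerD2r lerD2l lerMn2r/= -sqrtrM//.
rewrite (le_trans (ler_norm _))// -sqrtr_sqr ler_wsqrtr//.
Qed.

HB.instance Definition _ := isMetric.Build R euclidean
  euclidean_distxx euclidean_dist_positivity euclidean_dist_sym
  euclidean_dist_triangle.

End euclidean.

(* A nonempty subset X of a metric space as a metric space of its own, with the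
   induced distance. *)
Section metric_subset.
Variables (R : realType) (T : metricType R) (X : set T) (X0 : X !=set0).

Definition metric_subset of X !=set0 : Type := X.

Local Notation S := (metric_subset X0).

HB.instance Definition _ := Choice.on S.
HB.instance Definition _ := isPointed.Build S
  (exist _ (sval (cid X0)) (mem_set (svalP (cid X0)))).

Let dist (x y : S) : R := mdist (val x) (val y).

Let distxx x : dist x x = 0. Proof. exact: mdistxx. Qed.

Let dist_positivity x y : dist x y = 0 -> x = y.
Proof. by move=> /mdist_positivity/val_inj. Qed.

Let dist_sym x y : dist x y = dist y x. Proof. exact: metric_sym. Qed.

Let dist_triangle y x z : dist x z <= dist x y + dist y z.
Proof. exact: metric_triangle. Qed.

HB.instance Definition _ := isMetric.Build R S
  distxx dist_positivity dist_sym dist_triangle.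

End metric_subset.

Definition borel (T : ptopologicalType) := g_sigma_algebraType (@open T).

(* Borel probability measures on T with the weak topology: the initial topology
   for the maps P |-> P(f), f continuous and bounded. *)
Section weak_topology.
Variables (R : realType) (T : ptopologicalType).

Definition Prob : Type := probability (borel T) R.

HB.instance Definition _ := Pointed.on Prob.

Definition mean (f : T -> R) (P : Prob) : R :=
  (\int[(P : probability (borel T) R)]_x f x)%R.

Definition Cb := {f : T -> R | continuous f /\ bounded_fun f}.

HB.instance Definition _ := PointedTopological.copy Prob
  (sup_topology (fun f : Cb =>
    Topological.on (initial_topology (mean (sval f))))).

End weak_topology.

Local Open Scope ereal_scope.

(* mu and nu are plain set functions, so that the laws of P(f) can be written as
   pushforwards inside a supremum over f; when P |-> P(f) is measurable (f
   Lipschitz on a bounded space) these pushforwards are probability measures. *)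
Section wasserstein.
Variable R : realType.

Definition coupling (mu nu : set R -> \bar R) (g : probability (R * R)%type R)
    : Prop :=
  forall A : set R, measurable A ->
    g (A `*` setT) = mu A /\ g (setT `*` A) = nu A.

Definition wasserstein (mu nu : set R -> \bar R) : \bar R :=
  ereal_inf [set \int[g]_z (`|z.1 - z.2|)%:E | g in coupling mu nu].

End wasserstein.

Definition lip1 (R : realType) (T : metricType R) (f : T -> R) : Prop :=
  forall x y, (`|f x - f y| <= mdist x y)%R.

Definition dLip (R : realType) (T : pmetricType R) (Q1 Q2 : Prob R (Prob R T))
    : \bar R :=
  ereal_sup [set wasserstein
                   (pushforward (Q1 : probability (borel (Prob R T)) R) (mean f))
                   (pushforward (Q2 : probability (borel (Prob R T)) R) (mean f))
            | f in lip1 (T := T)].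

Section empirical.
Context d (T : measurableType d) (R : realType) (n : nat).

Definition empirical of (0 < n)%N := fun (x : 'I_n -> T) (A : set T) =>
  ((n%:R^-1)%R : R)%:E * \sum_(i < n) dirac (x i) A : \bar R.

Variables (n0 : (0 < n)%N) (x : 'I_n -> T).

Let empiricalE : empirical n0 x = mscale (n%:R^-1)%:nng%R
  (msum (fun k => dirac (if insub k is Some i then x i else point)) n).
Proof.
apply/funext => A; rewrite /empirical /mscale /msum/=; congr (_ * _).
by apply: eq_bigr => i _; rewrite valK.
Qed.

Let empirical0 : empirical n0 x set0 = 0.
Proof. by rewrite empiricalE measure0. Qed.

Let empirical_ge0 A : 0 <= empirical n0 x A.
Proof. by rewrite empiricalE measure_ge0. Qed.

Let empirical_sigma_additive : semi_sigma_additive (empirical n0 x).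
Proof. by rewrite empiricalE; exact: measure_semi_sigma_additive. Qed.

HB.instance Definition _ := isMeasure.Build _ _ _ (empirical n0 x)
  empirical0 empirical_ge0 empirical_sigma_additive.

Let empiricalT : empirical n0 x setT = 1.
Proof.
rewrite /empirical; under eq_bigr do rewrite diracT.
rewrite sumEFin sumr_const card_ord -EFinM mulVf//.
by rewrite pnatr_eq0 -lt0n.
Qed.

HB.instance Definition _ := Measure_isProbability.Build _ _ _
  (empirical n0 x) empiricalT.

End empirical.

Section iid.
Context d d' (W : measurableType d) (T : measurableType d') (R : realType).

Definition mutually_independent (n : nat) (P : probability W R)
    (X : 'I_n -> {RV P >-> T}) : Prop :=
  forall (J : {set 'I_n}) (A : 'I_n -> set T), (forall i, measurable (A i)) ->
    P (\bigcap_(i in [set` J]) (X i @^-1` A i)) =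
    \prod_(i in J) P (X i @^-1` A i).

Definition iid (n : nat) (P : probability W R) (Q : probability T R)
    (X : 'I_n -> {RV P >-> T}) : Prop :=
  mutually_independent X /\
  forall i A, measurable A -> distribution P (X i) A = Q A.

End iid.

Local Close Scope ereal_scope.

Definition rate (R : realType) (d n : nat) : R :=
  if d == 1%N then n%:R `^ (- (1 / 2))
  else if d == 2%N then n%:R `^ (- (1 / 2)) * ln n%:R
  else n%:R `^ (- (1 / d%:R)).

(* Main.v *)
Require Import Defs.
From HB Require Import structures.
From mathcomp Require Import all_boot all_order all_algebra.
From mathcomp Require Import all_classical all_reals all_analysis.
From mathcomp Require Import measurable_realfun ring lra zify.

Set Implicit Arguments.
Unset Strict Implicit.
Unset Printing Implicit Defensive.

Import Order.TTheory GRing.Theory Num.Theory.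
Import numFieldNormedType.Exports.

Local Open Scope classical_set_scope.
Local Open Scope ring_scope.

(** On the line, Kantorovich duality turns the Wasserstein distance between the
    laws of P(f) under Q_n and Q into a supremum over 1-Lipschitz g of (Q_n -
    Q)(h) with h(p) = g(p(f)). So the Lipschitz distance is the supremum of an
    empirical process indexed by pairs of 1-Lipschitz functions f on X and g on
    the line, and constants cancel, so f and g may be assumed to vanish at a
    base point.

    The size of this process is governed by the metric entropy of the class in
    the sup norm. A 1-Lipschitz function on X is known up to order 2^-k once it
    is rounded to multiples of 2^-k on the cells of a grid with 2^(dk) cells.
    Given the rounding at scale k, each rounded value at scale k+1 can only
    take boundedly many values, so there are at most exp(c 2^(dk)) roundings,
    with no logarithmic factor in the exponent ([lipschitz_code]). The
    functions g on a bounded interval are the case d = 1, which is absorbed.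

    Chaining over the scales k <= K ([chaining]) then bounds the expected
    supremum by a multiple of sum_k 2^-k sqrt(2^(dk) / n) + 2^-K: each link is
    a maximum of at most exp(m) centred averages of size 2^-k, and the
    exponential moments of such averages bound its expectation by 2^-k sqrt(m /
    n) ([maximal_inequality]). Taking 2^(dK) of the order of n, the sum is
    bounded for d = 1, has K + 1 equal terms for d = 2, and is dominated by its
    last term, of order 2^-K ~ n^(-1/d), for d > 2; this gives the three rates
    ([rate_bound]).

    The distance need not be a measurable function of the sample. Every bound
    above is therefore pointwise: the supremum is dominated by an explicit
    measurable function (a sum of exponentials of the deviations) whose
    integral is then estimated. *)

(** * Integrals of bounded functions against a probability *)

(** Stated with the norm, so that the line needs no structure of metric type.
    *)
Definition lipR (R : realType) (g : R -> R) :=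
  forall x y, `|g x - g y| <= `|x - y|.

Lemma lipR_continuous (R : realType) (g : R -> R) : lipR g -> continuous g.
Proof.
move=> gl x; apply/cvgrPdist_lt => e e0; near=> y.
apply: le_lt_trans (gl _ _) _; near: y.
exact: (@cvgr_dist_lt _ _ _ (nbhs x) _ id x).
Unshelve. all: by end_near. Qed.

Lemma lipR_measurable (R : realType) (g : R -> R) : lipR g ->
  measurable_fun setT g.
Proof. by move/lipR_continuous; exact: continuous_measurable_fun. Qed.

Lemma bounded_integrable d (T : measurableType d) (R : realType)
    (P : probability T R) (f : T -> R) (M : R) :
  measurable_fun setT f -> (forall t, `|f t| <= M) ->
  P.-integrable setT (EFin \o f).
Proof.
move=> mf fM; apply: measurable_bounded_integrable => //.
  by rewrite (le_lt_trans (probability_le1 _ _))// ltry.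
exists M; split; [exact: num_real|] => x Mx t _ /=.
exact: (le_trans (fM t) (ltW Mx)).
Qed.

Lemma integral_cst_prob d (T : measurableType d) (R : realType)
    (P : probability T R) (c : R) : (\int[P]_t c%:E = c%:E)%E.
Proof. by rewrite integral_cst// [X in (_ * X)%E]probability_setT mule1. Qed.

Lemma Rintegral_cst_prob d (T : measurableType d) (R : realType)
    (P : probability T R) (c : R) : (\int[P]_t c)%R = c.
Proof. by rewrite Rintegral_cst// [X in fine X]probability_setT mulr1. Qed.

Lemma normr_Rintegral_le d (T : measurableType d) (R : realType)
    (Q : probability T R) (Y : T -> R) s : measurable_fun setT Y ->
  (forall t, `|Y t| <= s) -> `|(\int[Q]_t Y t)%R| <= s.
Proof.
move=> mY Ys; have iY := bounded_integrable Q mY Ys.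
have ic : Q.-integrable setT (EFin \o (fun=> s)).
  by apply: (@bounded_integrable _ _ _ _ _ `|s|).
have iN := integrable_norm iY.
rewrite (le_trans (le_normr_Rintegral measurableT iY))//.
rewrite -[leRHS](Rintegral_cst_prob Q).
by apply: le_Rintegral => // t _; exact: Ys.
Qed.

(** The integral of a nonnegative function is the supremum of the integrals of
    the simple functions below it, measurable or not; enlarging the function
    enlarges that family. This bounds the integral of a supremum over an
    uncountable class. *)
Lemma ge0_le_integral_nonmeasurable d (T : measurableType d) (R : realType)
    (mu : {measure set T -> \bar R}) (f g : T -> \bar R) :
  (forall x, 0 <= f x)%E -> (forall x, f x <= g x)%E ->
  (\int[mu]_x f x <= \int[mu]_x g x)%E.
Proof.
move=> f0 fg; rewrite !ge0_integralTE//; last first.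
  by move=> x; exact: le_trans (fg x).
apply: le_ereal_sup => _ [h hf <-]; exists h => // x.
exact: le_trans (fg x).
Qed.

(** * Quantile functions *)

Section quantile.
Context d (T : measurableType d) (R : realType) (P : probability T R).
Variables (X : {RV P >-> R}) (L : R).
Hypothesis L0 : 0 <= L.

(** The generalized inverse of the distribution function, for a variable with
    values in [-L, L]. Restricting the infimum to [-L, L] makes it finite and
    monotone for every real u, not only for u in ]0, 1[. *)
Definition quantile (u : R) : R :=
  inf [set t | - L <= t /\ (L <= t \/ (u%:E <= cdf X t)%E)].

Let set_L u : [set t | - L <= t /\ (L <= t \/ (u%:E <= cdf X t)%E)] L.
Proof. by split; [rewrite ge0_cp|left]. Qed.

Let set_lb u :
  has_lbound [set t | - L <= t /\ (L <= t \/ (u%:E <= cdf X t)%E)].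
Proof. by exists (- L) => t []. Qed.

Lemma quantile_itv u : `|quantile u| <= L.
Proof.
rewrite ler_norml; apply/andP; split.
  by apply: lb_le_inf; [exists L; exact: set_L | move=> t []].
by apply: ge_inf => //; exact: set_L.
Qed.

Lemma quantile_nd : nondecreasing_fun quantile.
Proof.
move=> u v uv; apply: lb_le_inf; first by exists L; exact: set_L.
move=> t [t1 t2]; apply: ge_inf => //; split=> //.
by case: t2 => [|t2]; [left|right; rewrite (le_trans _ t2)// lee_fin].
Qed.

(** The Galois connection between the quantile and the distribution function;
    one direction is right continuity of the latter. *)
Lemma quantile_le u t : - L <= t -> t < L ->
  (quantile u <= t) = (u%:E <= cdf X t)%E.
Proof.
move=> Lt tL; apply/idP/idP => [qt|ut]; last first.
  by apply: ge_inf => //; split=> //; right.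
have H s : t < s -> s < L -> (u%:E <= cdf X s)%E.
  move=> ts sL.
  have hi : has_inf [set t | - L <= t /\ (L <= t \/ (u%:E <= cdf X t)%E)].
    by split => //; exists L; exact: set_L.
  have st0 : 0 < s - t by rewrite subr_gt0.
  have [r [Lr rLu]] := inf_adherent st0 hi; rewrite -/(quantile u) => rq.
  have rs : r < s.
    by rewrite (lt_le_trans rq)// -lerBrDr opprB addrCA subrr addr0.
  case: rLu => [rL|ur]; first by move: (lt_trans rs sL); rewrite ltNge rL.
  by apply: (le_trans ur); apply: cdf_nondecreasing; exact: ltW.
have cv := @cdf_right_continuous _ _ _ _ X t.
apply: (@cvge_ge _ _ _ _ _ _ _ _ cv); near=> s.
apply: H; near: s; first exact: nbhs_right_gt.
exact: nbhs_right_lt.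
Unshelve. all: by end_near. Qed.

Lemma measurable_quantile :
  measurable_fun [set: measurableTypeR R] (quantile : measurableTypeR R -> R).
Proof. exact: nondecreasing_measurable quantile_nd. Qed.

End quantile.

Lemma uniform_prob01_ray (R : realType) (c : R) : 0 <= c -> c <= 1 ->
  uniform_prob (@ltr01 R) `]-oo, c] = c%:E.
Proof.
move=> c0 c1.
transitivity (\int[uniform_prob (@ltr01 R)]_x (\1_(`]-oo, c]%classic) x)%:E)%E.
  by rewrite integral_indic// setIT.
rewrite integral_uniform//; last exact/measurable_EFinP/measurable_indic.
rewrite subr0 invr1 mul1e integral_indic// (_ : _ `&` _ = `[0, c]%classic).
  apply: etrans (lebesgue_measure_itv `[0, c]) _; rewrite /= lte_fin;
    have [//|c0'] := ltP 0 c.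
    by rewrite oppr0 adde0.
  by congr (_%:E); apply/eqP; rewrite eq_le c0 c0'.
apply/seteqP; split => x/=; rewrite !in_itv/=.
  by move=> [xc /andP[-> _]].
by move=> /andP[-> xc]; rewrite xc (le_trans xc).
Qed.

(** The inverse transform: the quantile of a uniform variable has the law of X.
    It is enough to compare both laws on the rays ]t, +oo[, and there
    [quantile_le] reduces the claim to the mass of an interval. *)
Lemma quantile_distribution d (T : measurableType d) (R : realType)
    (P : probability T R) (X : {RV P >-> R}) (L : R) (L0 : 0 <= L)
    (XL : forall t, `|X t| <= L) (A : set R) : measurable A ->
  uniform_prob (@ltr01 R) (quantile X L @^-1` A) = P (X @^-1` A).
Proof.
move=> mA.
pose U := uniform_prob (@ltr01 R).
have mq := measurable_quantile X L0.
pose qX : {RV U >-> R} := HB.pack (quantile X L)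
  (isMeasurableFun.Build _ _ _ _ _ mq).
suff: distribution U qX A = distribution P X A by [].
apply: (measure_unique (@RGenOInfty.G R)
  (fun k => `]- k%:R, +oo[%classic)) => //.
- exact: RGenOInfty.measurableE.
- move=> _ _ [r ->] [s ->]; exists (Num.max r s).
  by apply/seteqP; split => x/=; rewrite !in_itv/= !andbT gt_max;
    [move=> [-> ->]|move=> /andP[]].
- by move=> k; exists (- k%:R).
- rewrite -subTset => x _; exists (Num.truncn (- x)).+1 => //=.
  by rewrite in_itv/= andbT ltrNl truncnS_gt.
- move=> _ [t ->].
  have E (dd : measure_display) (S : measurableType dd) (M : probability S R)
      (Y : {RV M >-> R}) : distribution M Y `]t, +oo[ = (1 - cdf Y t)%E.
    by rewrite /cdf -(@probability_setC _ _ _ (distribution M Y))// setCitvl.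
  apply: etrans (E _ _ _ qX) (etrans _ (esym (E _ _ _ X))).
  congr (1 - _)%E; rewrite /cdf /distribution /pushforward.
  (* Outside [-L, L] both laws give no mass, or full mass, to ]-oo, t]; inside,
     the Galois connection applies. *)
  have [tL|tL] := ltP t (- L).
    rewrite (_ : qX @^-1` _ = set0) ?measure0.
      rewrite (_ : X @^-1` _ = set0) ?measure0//; rewrite -subset0 => x/=.
      rewrite in_itv/= leNgt (lt_le_trans tL)// lerNl.
      by rewrite (le_trans (ler_norm _))// normrN.
    rewrite -subset0 => x/=; rewrite in_itv/= leNgt (lt_le_trans tL)// lerNl.
    by rewrite (le_trans (ler_norm _))// normrN quantile_itv.
  have [Lt|Lt] := leP L t.
    have H dd (S : measurableType dd) (M : probability S R)
        (Y : {RV M >-> R}) : (forall s, `|Y s| <= L) ->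
        M (Y @^-1` `]-oo, t]) = 1%E.
      move=> YL; rewrite -(@probability_setT _ _ _ M); congr (M _).
      apply/seteqP; split => // x _ /=; rewrite in_itv/= (le_trans _ Lt)//.
      by rewrite (le_trans (ler_norm _)).
    by rewrite !H//; exact: quantile_itv.
  have F : cdf X t \is a fin_num by rewrite fin_num_measure.
  transitivity (uniform_prob (@ltr01 R) `]-oo, fine (cdf X t)]).
    congr (uniform_prob _ _); apply/seteqP; split => u/=; rewrite !in_itv/=.
      by rewrite quantile_le// -lee_fin fineK.
    by rewrite quantile_le// -lee_fin fineK.
  rewrite uniform_prob01_ray ?fineK ?fine_ge0 ?cdf_ge0//.
  by rewrite -lee_fin fineK// cdf_le1.
- by move=> k; rewrite (le_lt_trans (probability_le1 _ _))// ?ltry.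
Qed.

(** * Ramps on a grid *)

Section ramps.
Variables (R : realType) (L : R) (m : nat).
Hypotheses (L0 : 0 <= L) (m0 : (0 < m)%N).

Local Notation mesh := (2 * L / m%:R).

Definition knot (j : nat) : R := - L + j%:R * mesh.

Let hinge (j : nat) (x : R) : R := Num.max (x - knot j) 0.

(** The distance from knot j to x, cut to the j-th cell of the grid: a
    continuous version of (mesh) * 1_{x > knot j}. *)
Definition ramp (j : nat) (x : R) : R := hinge j x - hinge j.+1 x.

Let mesh_ge0 : 0 <= mesh. Proof. by rewrite divr_ge0// mulr_ge0. Qed.

Let knotS j : knot j.+1 = knot j + mesh.
Proof. by rewrite /knot -natr1; ring. Qed.

Let knotm : knot m = L.
Proof. by rewrite /knot; field; rewrite pnatr_eq0 -lt0n. Qed.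

Let ramp_nd j x y : x <= y -> ramp j x <= ramp j y.
Proof.
move=> xy; rewrite /ramp /hinge knotS.
have := mesh_ge0; set e := mesh; set t := knot j => e0.
by rewrite !maxEle; do 4 case: ifPn; lra.
Qed.

Let sum_ramp x : \sum_(j < m) ramp j x = hinge 0 x - hinge m x.
Proof.
rewrite -(big_mkord xpredT (ramp^~ x)) /ramp.
elim: m => [|k IH]; first by rewrite big_nil subrr.
by rewrite big_nat_recr//= IH addrA subrK.
Qed.

Let sum_ramp_lip x y : x <= y ->
  \sum_(j < m) ramp j y - \sum_(j < m) ramp j x <= y - x.
Proof.
move=> xy; rewrite !sum_ramp /hinge knotm.
have -> : knot 0 = - L by rewrite /knot mul0r addr0.
by rewrite !maxEle; do 4 case: ifPn; lra.
Qed.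

Lemma dist_sum_ramp x y : `|x| <= L -> `|y| <= L ->
  `|x - y| <= \sum_(j < m) `|ramp j x - ramp j y|.
Proof.
move=> xL yL; apply: le_trans (ler_norm_sum _ _ _).
rewrite sumrB !sum_ramp /hinge knotm.
have -> : knot 0 = - L by rewrite /knot mul0r addr0.
have E z : `|z| <= L -> Num.max (z - - L) 0 - Num.max (z - L) 0 = z + L.
  by rewrite ler_norml !maxEle => /andP[z1 z2]; do 2 case: ifPn; lra.
by rewrite !E// (_ : x + L - _ = x - y)//; ring.
Qed.

(** What smoothing costs: the gap is carried by the j-th cell, so that the gaps
    at a given point add up to at most one mesh. *)
Let gap j x := mesh * (knot j < x)%R%:R - ramp j x.

Let gap_ge0 j x : 0 <= gap j x.
Proof.
rewrite /gap /ramp /hinge knotS.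
have := mesh_ge0; set e := mesh; set t := knot j => e0.
by rewrite !maxEle; case: ltP => ?; do 2 case: ifPn => ?;
  rewrite ?mulr1 ?mulr0; lra.
Qed.

Let gap_le j x :
  gap j x <= mesh * (knot j < x)%R%:R - mesh * (knot j.+1 < x)%R%:R.
Proof.
rewrite /gap /ramp /hinge knotS.
have := mesh_ge0; set e := mesh; set t := knot j => e0.
by rewrite !maxEle; do 2 case: ltP => ?; do 2 case: ifPn => ?;
  rewrite ?mulr1 ?mulr0; lra.
Qed.

Let sum_gap x : \sum_(j < m) gap j x <= mesh.
Proof.
apply: (@le_trans _ _ (mesh * (knot 0 < x)%R%:R - mesh * (knot m < x)%R%:R)).
  apply: le_trans (ler_sum _ (fun j _ => gap_le _ _)) _.
  rewrite -(big_mkord xpredT (fun j =>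
    mesh * (knot j < x)%R%:R - mesh * (knot j.+1 < x)%R%:R)).
  rewrite le_eqVlt; apply/orP; left; apply/eqP; set e := mesh.
  elim: m => [|k IH]; first by rewrite big_nil subrr.
  by rewrite big_nat_recr//= IH addrA subrK.
have := mesh_ge0; set e := mesh => e0.
by do 2 case: (_ < _)%R; rewrite ?mulr1 ?mulr0; lra.
Qed.

(** Up to the mesh, |x - y| is the mesh times the number of knots between x and
    y. If for each knot the sign of the difference of the two indicators is
    known in advance, the absolute values can be traded for signs; replacing
    the indicators by ramps, which makes the result a difference of values of
    one Lipschitz function, costs four meshes. *)
Lemma signed_ramps (s : nat -> R) x y : (forall j, `|s j| <= 1) ->
  `|x| <= L -> `|y| <= L ->
  (forall j, (j < m)%N -> `|(knot j < x)%R%:R - (knot j < y)%R%:R| =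
     s j * ((knot j < x)%R%:R - (knot j < y)%R%:R)) ->
  `|x - y| <= \sum_(j < m) s j * ramp j x - \sum_(j < m) s j * ramp j y
     + 4 * mesh.
Proof.
move=> s1 xL yL sE; apply: le_trans (dist_sum_ramp xL yL) _.
apply: (@le_trans _ _ (\sum_(j < m) (s j * ramp j x - s j * ramp j y +
   2 * (gap j x + gap j y)))); last first.
  rewrite big_split/= sumrB -mulr_sumr lerD2l big_split/=.
  have := sum_gap x; have := sum_gap y; set e := mesh.
  by move: (\sum_(_ < _) _) => a; move: (\sum_(_ < _) _) => b; lra.
apply: ler_sum => j _; have := sE j (ltn_ord j).
have := gap_ge0 j x; have := gap_ge0 j y; have := s1 j.
have -> : ramp j x = mesh * (knot j < x)%R%:R - gap j x by rewrite /gap; ring.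
have -> : ramp j y = mesh * (knot j < y)%R%:R - gap j y by rewrite /gap; ring.
move: (gap j x) (gap j y) => p q; have := mesh_ge0.
move: mesh (knot j < x)%R%:R (knot j < y)%R%:R => e a b e0 sj q0 p0 E.
have H : `|e * a - p - (e * b - q)| <= e * `|a - b| + p + q.
  rewrite -[X in X * `|_|](ger0_norm e0) -normrM.
  rewrite (_ : _ - _ = e * (a - b) - p + q); last by ring.
  rewrite (le_trans (ler_normD _ _))// (ger0_norm q0) lerD2r.
  by rewrite (le_trans (ler_normB _ _))// (ger0_norm p0).
have H2 : s j * (p - q) <= p + q.
  rewrite (le_trans (ler_norm _))// normrM.
  rewrite (@le_trans _ _ (1 * `|p - q|))// ?ler_wpM2r// mul1r.
  by rewrite ler_norml; lra.
rewrite (le_trans H)// E -subr_ge0.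
rewrite (_ : _ - _ = p + q - s j * (p - q)) ?subr_ge0//; ring.
Qed.

(** All the ramps are nondecreasing and they sum up to a 1-Lipschitz function,
    so signs can only decrease the variation. *)
Lemma lip_signed_ramps (s : nat -> R) x y : (forall j, `|s j| <= 1) ->
  `|\sum_(j < m) s j * ramp j x - \sum_(j < m) s j * ramp j y| <= `|x - y|.
Proof.
move=> s1; wlog xy : x y / x <= y => [H|].
  by have [/H//|/ltW/H] := leP x y; rewrite distrC (distrC y).
rewrite (distrC x) (ger0_norm (_ : 0 <= y - x)) ?subr_ge0//.
apply: le_trans (sum_ramp_lip xy).
rewrite -!sumrB (le_trans (ler_norm_sum _ _ _))//; apply: ler_sum => j _.
have H : 0 <= ramp j y - ramp j x by rewrite subr_ge0 ramp_nd.
by rewrite -mulrBr normrM distrC (ger0_norm H) ler_piMl.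
Qed.

End ramps.

Lemma knot_itv (R : realType) (L : R) m j : 0 < L -> (j < m)%N ->
  - L <= knot L m j < L.
Proof.
move=> L0 jm; have m0 : (0 < m)%N by case: m jm.
have m0' : 0 < m%:R :> R by rewrite ltr0n.
rewrite /knot lerDl mulr_ge0 ?divr_ge0 ?mulr_ge0 ?(ltW L0)//=.
rewrite -ltrBrDl opprK mulrA ltr_pdivrMr//.
rewrite (_ : (L + L) * m%:R = m%:R * (2 * L)); last by ring.
by rewrite ltr_pM2r ?ltr_nat// mulr_gt0.
Qed.

(** * The Wasserstein distance on the line *)

Lemma Rintegral_quantile d (T : measurableType d) (R : realType)
    (P : probability T R) (X : {RV P >-> R}) (L : R) (L0 : 0 <= L)
    (XL : forall t, `|X t| <= L) (g : R -> R) : lipR g ->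
  (\int[uniform_prob (@ltr01 R)]_u g (quantile X L u) = \int[P]_t g (X t))%R.
Proof.
move=> gl; pose U := uniform_prob (@ltr01 R).
pose qX : {RV U >-> R} := HB.pack (quantile X L)
  (isMeasurableFun.Build _ _ _ _ _ (measurable_quantile X L0)).
have gb x : `|x| <= L -> `|g x| <= `|g 0| + L.
  move=> xL; rewrite -[g x](subrK (g 0)) (le_trans (ler_normD _ _))// addrC.
  by rewrite lerD2l (le_trans (gl _ _))// subr0.
have mg := lipR_measurable gl.
rewrite /Rintegral; congr fine.
transitivity (\int[distribution U qX]_y (g y)%:E)%E.
  rewrite integral_distribution//; first exact/measurable_EFinP.
  apply: (@bounded_integrable _ _ _ _ (g \o qX) (`|g 0| + L)).
    exact: measurableT_comp.
  by move=> u; apply: gb; exact: quantile_itv.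
transitivity (\int[distribution P X]_y (g y)%:E)%E; last first.
  rewrite integral_distribution//; first exact/measurable_EFinP.
  apply: (@bounded_integrable _ _ _ _ (g \o X) (`|g 0| + L)).
    exact: measurableT_comp.
  by move=> u; exact: gb.
apply: eq_measure_integral => A mA _.
by apply: quantile_distribution.
Qed.

(** Under the quantile coupling the events {X > t} and {Y > t} are intervals of
    the same uniform variable with the same right end, hence nested, and which
    one is larger depends on t only: this provides the signs for
    [signed_ramps]. Integrating the pointwise bound gives duality up to the
    mesh, with an explicit dual function. *)
Lemma wasserstein_le_ramps d1 (T1 : measurableType d1)
    d2 (T2 : measurableType d2) (R : realType)
    (P1 : probability T1 R) (P2 : probability T2 R)
    (X : {RV P1 >-> R}) (Y : {RV P2 >-> R}) (L : R) (L0 : 0 < L)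
    (XL : forall t, `|X t| <= L) (YL : forall t, `|Y t| <= L)
    m (m0 : (0 < m)%N) :
  exists2 g : R -> R, lipR g &
  (wasserstein (pushforward P1 X) (pushforward P2 Y) <=
    ((\int[P1]_t g (X t))%R - (\int[P2]_t g (Y t))%R +
      4 * (2 * L / m%:R))%:E)%E.
Proof.
have L0' := ltW L0.
pose s j : R := if (cdf X (knot L m j) <= cdf Y (knot L m j))%E then 1 else -1.
have s1 j : `|s j| <= 1 by rewrite /s; case: ifP; rewrite ?normrN normr1.
pose g x := \sum_(j < m) s j * ramp L m j x.
have gl : lipR g by move=> x y; exact: lip_signed_ramps.
exists g => //.
pose U := uniform_prob (@ltr01 R).
pose qX : {RV U >-> R} := HB.pack (quantile X L)
  (isMeasurableFun.Build _ _ _ _ _ (measurable_quantile X L0')).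
pose qY : {RV U >-> R} := HB.pack (quantile Y L)
  (isMeasurableFun.Build _ _ _ _ _ (measurable_quantile Y L0')).
have qXL u : `|qX u| <= L by exact: quantile_itv.
have qYL u : `|qY u| <= L by exact: quantile_itv.
have mXY : measurable_fun setT (fun u => (qX u, qY u)).
  exact: measurable_fun_pair.
pose q : {RV U >-> (R * R)%type} := HB.pack (fun u => (qX u, qY u))
  (isMeasurableFun.Build _ _ _ _ _ mXY).
(* The knot lies below the quantile of level u iff its distribution function is
   smaller than u, so the sign is read off the two distribution functions. *)
have key u : `|qX u - qY u| <= g (qX u) - g (qY u) + 4 * (2 * L / m%:R).
  apply: signed_ramps => // j jm.
  have /andP[k1 k2] := knot_itv L0 jm.
  have EX : (knot L m j < qX u) = (cdf X (knot L m j) < u%:E)%E.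
    by rewrite ltNge quantile_le// -ltNge.
  have EY : (knot L m j < qY u) = (cdf Y (knot L m j) < u%:E)%E.
    by rewrite ltNge quantile_le// -ltNge.
  rewrite EX EY /s; case: ifPn => [XY|].
    rewrite mul1r; case: (ltP _ u%:E) => cX; case: (ltP _ u%:E) => cY;
      rewrite ?subrr ?normr0 ?subr0 ?normr1//.
    by have := lt_le_trans (le_lt_trans XY cY) cX; rewrite ltxx.
  rewrite -ltNge => YX.
  case: (ltP _ u%:E) => cX; case: (ltP _ u%:E) => cY;
      rewrite ?subrr ?normr0 ?subr0 ?sub0r ?normrN ?normr1 ?mulr0 ?mulN1r
        ?opprK//.
  by have := lt_le_trans (lt_trans YX cX) cY; rewrite ltxx.
apply: (@le_trans _ _ (\int[distribution U q]_z (`|z.1 - z.2|)%:E)%E).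
  apply: ereal_inf_lbound; exists (distribution U q) => //.
  move=> A mA; split; rewrite /= /pushforward.
    rewrite -(quantile_distribution L0' XL mA); congr (_ _).
    by apply/seteqP; split => u //= [].
  rewrite -(quantile_distribution L0' YL mA); congr (_ _).
  by apply/seteqP; split => u //= [].
have md := measurable_funB (measurable_quantile X L0')
  (measurable_quantile Y L0').
have mg := lipR_measurable gl.
have mgd := measurable_funB (measurableT_comp mg (measurable_quantile X L0'))
  (measurableT_comp mg (measurable_quantile Y L0')).
have gb x : `|x| <= L -> `|g x| <= `|g 0| + L.
  move=> xL; rewrite -[g x](subrK (g 0)) (le_trans (ler_normD _ _))// addrC.
  by rewrite lerD2l (le_trans (gl _ _))// subr0.
have igX : U.-integrable setT (EFin \o (g \o qX)).
  apply: (@bounded_integrable _ _ _ _ _ (`|g 0| + L)).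
    exact: measurableT_comp (lipR_measurable gl) _.
  by move=> u; exact: gb.
have igY : U.-integrable setT (EFin \o (g \o qY)).
  apply: (@bounded_integrable _ _ _ _ _ (`|g 0| + L)).
    exact: measurableT_comp (lipR_measurable gl) _.
  by move=> u; exact: gb.
have ig : U.-integrable setT (EFin \o (fun u => g (qX u) - g (qY u))).
  by rewrite (_ : _ \o _ = (EFin \o (g \o qX)) \- (EFin \o (g \o qY)))%E//;
    exact: integrableB.
have ic (c : R) : U.-integrable setT (EFin \o (fun=> c)).
  exact: (@bounded_integrable _ _ _ _ _ `|c|).
rewrite ge0_integral_distribution//; last 1 first.
  apply/measurable_EFinP; apply: measurableT_comp => //.
  exact: measurable_funB.
rewrite -(Rintegral_quantile L0' XL gl) -(Rintegral_quantile L0' YL gl).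
rewrite -RintegralB//.
apply: (@le_trans _ _
    (\int[U]_u (g (qX u) - g (qY u) + 4 * (2 * L / m%:R))%:E)%E).
  apply: ge0_le_integral => //=.
  - by apply/measurable_EFinP; apply: measurableT_comp => //; exact: md.
  - by apply/measurable_EFinP; apply: measurable_funD => //; exact: mgd.
  - by move=> u _; rewrite lee_fin; exact: key.
under eq_integral do rewrite EFinD.
rewrite (@integralD _ _ _ U _ measurableT _ _ ig (ic _)).
have -> (c : R) : (\int[U]_u c%:E = c%:E)%E.
  by rewrite integral_cst// [X in (_ * X)%E]probability_setT mule1.
by rewrite EFinD leeD2r// /Rintegral fineK//; exact: integrable_fin_num.
Qed.

(** The nontrivial half of Kantorovich duality on the line, for bounded
    variables. *)
Lemma wasserstein_le_dual d1 (T1 : measurableType d1)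
    d2 (T2 : measurableType d2) (R : realType)
    (P1 : probability T1 R) (P2 : probability T2 R)
    (X : {RV P1 >-> R}) (Y : {RV P2 >-> R}) (L : R)
    (XL : forall t, `|X t| <= L) (YL : forall t, `|Y t| <= L) (B : R) :
  (forall g : R -> R, lipR g ->
    (\int[P1]_t g (X t))%R - (\int[P2]_t g (Y t))%R <= B) ->
  (wasserstein (pushforward P1 X) (pushforward P2 Y) <= B%:E)%E.
Proof.
move=> H; apply/lee_addgt0Pr => e e0.
pose L' := `|L| + 1; have L0 : 0 < L' by rewrite ltr_wpDl.
have LL : L <= L' by rewrite (le_trans (ler_norm _))// lerDl.
pose m := (Num.truncn (4 * (2 * L') / e)).+1.
have [||g gl] := @wasserstein_le_ramps _ _ _ _ _ _ _ X Y L' L0 _ _ m isT.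
  1,2: by move=> t; exact: le_trans LL.
move=> /le_trans; apply; rewrite -EFinD lee_fin lerD ?H//.
rewrite mulrA ler_pdivrMr ?ltr0n// -ler_pdivrMl// mulrC.
by rewrite ltW// truncnS_gt.
Qed.

(** * Products over an i.i.d. sample *)

Import HBNNSimple.

(** An identity between measures extends from sets to functions: by linearity
    to simple functions, and by monotone convergence to their limits. Here the
    identity compares the image under X of the measure of density G with a
    multiple of Q. *)
Lemma ge0_integral_transfer d d' (W : measurableType d) (T : measurableType d')
    (R : realType)
    (P : {measure set W -> \bar R}) (Q : {measure set T -> \bar R})
    (X : W -> T) (G : W -> R) (c : R) :
  measurable_fun setT X -> measurable_fun setT G -> (forall w, 0 <= G w) ->
  0 <= c ->
  (forall A, measurable A ->
    (\int[P]_w (\1_A (X w) * G w)%:E = c%:E * Q A)%E) ->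
  forall f : T -> R, measurable_fun setT f -> (forall t, 0 <= f t) ->
    (\int[P]_w (f (X w) * G w)%:E = c%:E * \int[Q]_t (f t)%:E)%E.
Proof.
move=> mX mG G0 c0 H f mf f0.
have mef : measurable_fun setT (EFin \o f) by exact/measurable_EFinP.
have ef0 t : setT t -> (0 <= (EFin \o f) t)%E by move=> _; rewrite lee_fin.
pose h := nnsfun_approx measurableT mef.
have hcv t : (h n t)%:E @[n --> \oo] --> (f t)%:E.
  exact: (cvg_nnsfun_approx measurableT mef ef0).
have hnd t : {homo (h ^~ t) : m n / (m <= n)%N >-> m <= n}.
  by move=> m n mn; exact/lefP/nd_nnsfun_approx.
have mhX n : measurable_fun setT (h n \o X) by exact: measurableT_comp.
have -> : (c%:E * \int[Q]_t (f t)%:E = \int[Q]_t (c%:E * (f t)%:E))%E.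
  by rewrite ge0_integralZl.
transitivity (limn (fun n => \int[P]_w (h n (X w) * G w)%:E))%E.
  rewrite -monotone_convergence//.
  - apply: eq_integral => w _; apply/esym/cvg_lim => //.
    rewrite EFinM; under eq_fun do rewrite EFinM.
    by apply: cvgeZr => //; exact: hcv.
  - by move=> n; apply/measurable_EFinP; exact: (measurable_funM (mhX n) mG).
  - move=> n w _; by rewrite lee_fin; apply: mulr_ge0.
  - by move=> w _ m n mn; rewrite lee_fin ler_wpM2r// hnd.
transitivity (limn (fun n => \int[Q]_t (c%:E * (h n t)%:E)))%E; last first.
  rewrite -monotone_convergence//.
  - apply: eq_integral => t _; apply/cvg_lim => //.
    by apply: cvgeZl => //; exact: hcv.
  - move=> n; apply/measurable_EFinP; exact: measurable_funM.
  - by move=> n t _; rewrite -EFinM lee_fin mulr_ge0 ?fun_ge0.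
  - by move=> t _ m n mn; rewrite -!EFinM lee_fin ler_wpM2l// hnd.
congr (limn _); apply/funext => n; move: (h n) (mhX n) => k mk.
transitivity (\sum_(r \in range k)
    \int[P]_w (r * (\1_(k @^-1` [set r]) (X w) * G w))%:E)%E.
  rewrite -ge0_integral_fsum//; last 2 first.
  - move=> r; apply/measurable_EFinP; apply: measurable_funM => //.
    apply: measurable_funM => //; apply: measurableT_comp => //.
  - move=> r w _; rewrite lee_fin mulrA mulr_ge0//.
    have := nnfun_muleindic_ge0 k r (X w); rewrite -EFinM lee_fin.
    exact.
  apply: eq_integral => w _; rewrite fsumEFin//; congr (_%:E).
  rewrite [in LHS]fimfunE mulr_fsuml; apply: eq_fsbigr => r _; by rewrite mulrA.
transitivity (\sum_(r \in range k) (r%:E * (c%:E * Q (k @^-1` [set r]))))%E.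
  apply: eq_fsbigr => r; rewrite inE => -[t _ rt].
  have r0 : 0 <= r by rewrite -rt.
  under eq_integral do rewrite EFinM.
  rewrite ge0_integralZl//; last 2 first.
  - apply/measurable_EFinP; apply: measurable_funM => //.
    by apply: measurableT_comp.
  - by move=> w _; rewrite lee_fin mulr_ge0.
  - by rewrite H.
rewrite ge0_integralZl//; last 2 first.
- exact/measurable_EFinP.
- by move=> t _; rewrite lee_fin.
under [in RHS]eq_integral do rewrite fimfunE -fsumEFin//.
rewrite ge0_integral_fsum//; last 2 first.
- by move=> r; apply/measurable_EFinP; exact: measurable_funM.
- by move=> r x _; rewrite EFinM nnfun_muleindic_ge0.
rewrite ge0_mule_fsumr; last first.
  by move=> r; apply: integral_ge0 => x _; rewrite EFinM nnfun_muleindic_ge0.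
apply: eq_fsbigr => r _.
by rewrite integralZl_indic_nnsfun// integral_indic// setIT muleCA.
Qed.

(** Independence is a statement about events, that is about products of
    indicators. The indicators are replaced by the function f one index at a
    time, each replacement being an instance of [ge0_integral_transfer] where G
    is the product of the other factors. *)
Lemma iid_integral_prod dW (W : measurableType dW) d (T : measurableType d)
    (R : realType) (P : probability W R) (Q : probability T R) (n : nat)
    (X : 'I_n -> {RV P >-> T}) (f : T -> R) (M : R) :
  iid Q X -> measurable_fun setT f -> (forall t, 0 <= f t <= M) ->
  (\int[P]_w (\prod_i f (X i w))%:E = ((\int[Q]_t f t) ^+ n)%:E)%E.
Proof.
move=> [indX distX] mf fM; have f0 t : 0 <= f t by have /andP[] := fM t.
pose m := (\int[Q]_t f t)%R.
have mE : (\int[Q]_t (f t)%:E)%E = m%:E.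
  rewrite /m /Rintegral fineK//; apply: integrable_fin_num => //.
  by apply: (@bounded_integrable _ _ _ _ f M) => // t;
    rewrite ger0_norm; have /andP[] := fM t.
have m0 : 0 <= m by apply: Rintegral_ge0.
(* After k steps, the first k factors are f and the others are indicators of
   arbitrary sets. *)
pose psi k (A : 'I_n -> set T) (i : 'I_n) t :=
  if (i < k)%N then f t else \1_(A i) t.
pose mpsi k (A : 'I_n -> set T) (i : 'I_n) :=
  if (i < k)%N then m else fine (Q (A i)).
have mpsi0 k A i : 0 <= mpsi k A i.
  by rewrite /mpsi; case: ifP => // _; exact: fine_ge0.
have psi0 k A i t : 0 <= psi k A i t.
  by rewrite /psi; case: ifP => // _; rewrite indicE ler0n.
have psim k A i : (forall i, measurable (A i)) ->
    measurable_fun setT (psi k A i).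
  by move=> mA; rewrite /psi; case: (i < k)%N => //; exact: measurable_indic.
suff H k A : (forall i, measurable (A i)) -> (k <= n)%N ->
    (\int[P]_w (\prod_i psi k A i (X i w))%:E = (\prod_i mpsi k A i)%:E)%E.
  have := H n (fun=> setT) (fun=> measurableT) (leqnn n).
  rewrite [in RHS](eq_bigr (fun=> m)) ?prodr_const ?card_ord; last first.
    by move=> i _; rewrite /mpsi ltn_ord.
  move=> <-; apply: eq_integral => w _; congr EFin; apply: eq_bigr => i _.
  by rewrite /psi ltn_ord.
elim: k A => [|k IH] A mA kn.
  transitivity (\int[P]_w
      (\1_(\bigcap_(i in [set` [set: 'I_n]%SET]) (X i @^-1` A i)) w)%:E)%E.
    apply: eq_integral => w _; congr EFin; rewrite /psi /=.
    have [wA|wA] := pselect (forall i, A i (X i w)).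
      rewrite big1 => [|i _]; last by rewrite indicE mem_set.
      by rewrite indicE mem_set// => i _; exact: wA.
    have [i Ai] : exists i, ~ A i (X i w) by apply/existsNP.
    rewrite (bigD1 i)//= [X in X * _]indicE memNset// mul0r indicE memNset//.
    by apply/existsNP; exists i => /(_ (finset.in_setT _)).
  rewrite integral_indic//; last first.
    apply: fin_bigcap_measurable => // i _; exact: measurable_funPTI.
  rewrite setIT; apply: etrans (indX [set: 'I_n]%SET A mA) _.
  rewrite -prodEFin big_mkcond; apply: eq_bigr => i _.
  by rewrite finset.in_setT /mpsi ltn0 fineK ?fin_num_measure//; apply: distX.
pose o := Ordinal kn.
have oS : (o < k.+1)%N by rewrite /= ltnSn.
have oN : (o < k)%N = false by rewrite /= ltnn.
(* The induction hypothesis for A with its o-th set changed to B is what the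
   transfer lemma asks for. *)
pose upd B i := if i == o then B else A i.
have mupd B i : measurable B -> measurable (upd B i).
  by move=> mB; rewrite /upd; case: ifP.
pose G w := \prod_(i | i != o) psi k A i (X i w).
pose c := \prod_(i | i != o) mpsi k A i.
have nlt (i : 'I_n) : i != o -> (i < k.+1)%N = (i < k)%N.
  move=> io; rewrite ltnS leq_eqVlt.
  by rewrite (_ : (i == k :> nat) = false)//; apply/negbTE.
transitivity (\int[P]_w (f (X o w) * G w)%:E)%E.
  apply: eq_integral => w _; rewrite (bigD1 o)//= {1}/psi oS /G;
     congr (_ * _)%:E.
  by apply: eq_bigr => i io; rewrite /psi nlt.
rewrite (@ge0_integral_transfer _ _ _ _ _ _ Q _ _ c)//.
- rewrite mE -EFinM; congr EFin.
  rewrite [RHS](bigD1 o)//= [X in _ = X * _]/mpsi oS mulrC; congr (_ * _).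
  by apply: eq_bigr => i io; rewrite /mpsi nlt.
- rewrite /G; under eq_fun do rewrite -big_filter.
  apply: measurable_prod => i _; apply: measurableT_comp => //; exact: psim.
- by move=> w; apply: prodr_ge0 => i _.
- by apply: prodr_ge0 => i _.
- move=> B mB; have := IH (upd B) (fun i => mupd B i mB) (ltnW kn).
  rewrite (bigD1 o)//= {1}/mpsi oN /upd eqxx EFinM fineK ?fin_num_measure//.
  rewrite muleC => E; rewrite -[X in (X * _)%E]/(c%:E).
  transitivity (\int[P]_w (\prod_i psi k (upd B) i (X i w))%:E)%E.
    apply: eq_integral => w _; rewrite (bigD1 o)//= {1}/psi oN /upd eqxx.
    congr (_ * _)%:E; apply: eq_bigr => i io.
    by rewrite /psi (negbTE io).
  rewrite E; congr (_%:E * _)%E; apply: eq_bigr => i io.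
  by rewrite /mpsi (negbTE io).
Qed.

(** * Deviations of the empirical mean *)

(** From exp(-x) >= 1 - x, exp x is at most 1 / (1 - x). *)
Lemma expR_le_quadratic (R : realType) (x : R) : `|x| <= 1 / 2 ->
  expR x <= 1 + x + 2 * x ^+ 2.
Proof.
rewrite ler_norml => /andP[x1 x2].
have h : 1 - x <= expR (- x) by rewrite expR_ge1Dx.
have p : 0 < 1 - x by lra.
rewrite -[x in expR x]opprK expRN.
apply: (@le_trans _ _ (1 - x)^-1); first by rewrite lef_pV2// posrE expR_gt0.
rewrite -[_^-1]mul1r ler_pdivrMr//.
have -> : (1 + x + 2 * x ^+ 2) * (1 - x) = 1 + x ^+ 2 * (1 - 2 * x) by ring.
by rewrite lerDl mulr_ge0// ?sqr_ge0//; lra.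
Qed.

Section deviation.
Context dW (W : measurableType dW) d (T : measurableType d) (R : realType).
Variables (P : probability W R) (Q : probability T R) (n : nat).
Variable X : 'I_n -> {RV P >-> T}.

Definition deviation (Y : T -> R) (w : W) : R :=
  n%:R^-1 * \sum_i Y (X i w) - (\int[Q]_t Y t)%R.

Lemma measurable_deviation Y : measurable_fun setT Y ->
  measurable_fun setT (deviation Y).
Proof.
move=> mY; apply: measurable_funB => //; apply: measurable_funM => //.
by apply: measurable_sum => i; exact: measurableT_comp.
Qed.

Lemma deviationB Y1 Y2 w :
  Q.-integrable setT (EFin \o Y1) -> Q.-integrable setT (EFin \o Y2) ->
  deviation (fun t => Y1 t - Y2 t) w = deviation Y1 w - deviation Y2 w.
Proof. by move=> i1 i2; rewrite /deviation RintegralB// sumrB; ring. Qed.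

Lemma normr_deviation_le (Y : T -> R) s w :
  (0 < n)%N -> measurable_fun setT Y ->
  (forall t, `|Y t| <= s) -> `|deviation Y w| <= 2 * s.
Proof.
move=> n0 mY Ys; have n0' : 0 < n%:R :> R by rewrite ltr0n.
rewrite (le_trans (ler_normB _ _))// (_ : 2 * s = s + s); last by ring.
apply: lerD; last exact: normr_Rintegral_le.
rewrite normrM gtr0_norm ?invr_gt0// ler_pdivrMl//.
rewrite (le_trans (ler_norm_sum _ _ _))//.
rewrite (le_trans (ler_sum _ (fun i _ => Ys _)))//.
by rewrite sumr_const card_ord mulr_natl.
Qed.

(** The linear term of the quadratic bound on the exponential integrates to
    zero, so the moment generating function is 1 plus the order of the
    variance. *)
Lemma mgf_le (Y : T -> R) s t : measurable_fun setT Y ->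
  (forall t, `|Y t| <= s) ->
  `|t| * (2 * s) <= 1 / 2 ->
  (\int[Q]_x expR (t * (Y x - \int[Q]_y Y y)))%R <= expR (8 * s ^+ 2 * t ^+ 2).
Proof.
move=> mY Ys ts.
set mu := (\int[Q]_y Y y)%R.
have iY := bounded_integrable Q mY Ys.
have mc (c : R) : Q.-integrable setT (EFin \o cst c).
  exact: (@bounded_integrable _ _ _ _ _ `|c|).
have mu_s : `|mu| <= s by exact: normr_Rintegral_le.
have Ymu x : `|Y x - mu| <= 2 * s.
  by rewrite (le_trans (ler_normB _ _))// (_ : 2 * s = s + s) ?lerD//; ring.
have half x : `|t * (Y x - mu)| <= 1 / 2.
  by rewrite normrM (le_trans _ ts)// ler_wpM2l.
have mE : measurable_fun setT (fun x => expR (t * (Y x - mu))).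
  apply: measurableT_comp => //; apply: measurable_funM => //.
  exact: measurable_funB.
have iE : Q.-integrable setT (EFin \o (fun x => expR (t * (Y x - mu)))).
  apply: (@bounded_integrable _ _ _ _ _ (expR (1 / 2))) => // x.
  by rewrite ger0_norm ?expR_ge0// ler_expR (le_trans (ler_norm _)).
pose lin x := t * (Y x - mu).
have ilin : Q.-integrable setT (EFin \o lin).
  apply: (@bounded_integrable _ _ _ _ _ (1 / 2)) => //.
  by apply: measurable_funM => //; exact: measurable_funB.
pose K := 1 + 8 * s ^+ 2 * t ^+ 2.
apply: (@le_trans _ _ (\int[Q]_x (K + lin x))%R).
  apply: le_Rintegral => //.
    rewrite (_ : _ \o _ = (EFin \o cst K) \+ (EFin \o lin))%E//.
    exact: integrableD.
  move=> x _ /=; apply: le_trans (expR_le_quadratic (half x)) _.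
  rewrite /K addrAC lerD2r lerD2l exprMn.
  rewrite (_ : 8 * _ * _ = 2 * (t ^+ 2 * (2 * s) ^+ 2)); last by ring.
  rewrite ler_wpM2l// ler_wpM2l ?sqr_ge0//.
  rewrite -[leLHS]real_normK ?num_real//.
  by rewrite lerXn2r// nnegrE// (le_trans _ (Ymu x)).
rewrite (RintegralD measurableT (mc K) ilin) Rintegral_cst_prob.
rewrite /lin RintegralZl//; last first.
  rewrite (_ : _ \o _ = (EFin \o Y) \- (EFin \o cst mu))%E//.
  exact: integrableB.
rewrite (RintegralB measurableT iY (mc mu)) Rintegral_cst_prob -/mu subrr.
by rewrite mulr0 addr0 /K expR_ge1Dx.
Qed.

Lemma exp_deviation_le (Y : T -> R) s l : (0 < n)%N -> iid Q X ->
  measurable_fun setT Y -> (forall t, `|Y t| <= s) ->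
  `|l| * (4 * s) <= n%:R ->
  (\int[P]_w (expR (l * deviation Y w))%:E <=
    (expR (8 * s ^+ 2 * l ^+ 2 / n%:R))%:E)%E.
Proof.
move=> n0 iidX mY Ys ls; have n0' : 0 < n%:R :> R by rewrite ltr0n.
set mu := (\int[Q]_y Y y)%R; pose t := l / n%:R.
have ts : `|t| * (2 * s) <= 1 / 2.
  rewrite /t normrM (gtr0_norm (_ : 0 < n%:R^-1)) ?invr_gt0//.
  rewrite mulrAC ler_pdivrMr//.
  by move: ls; set a := `|l|; set b := n%:R; nra.
pose f x := expR (t * (Y x - mu)).
have mf : measurable_fun setT f.
  apply: measurableT_comp => //; apply: measurable_funM => //.
  exact: measurable_funB.
have fM x : 0 <= f x <= expR (1 / 2).
  rewrite expR_ge0 ler_expR (le_trans (ler_norm _))// normrM (le_trans _ ts)//.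
  rewrite ler_wpM2l// (le_trans (ler_normB _ _))//.
  by rewrite (_ : 2 * s = s + s) ?lerD ?normr_Rintegral_le//; ring.
rewrite (eq_integral (fun w => (\prod_i f (X i w))%:E)); last first.
  move=> w _; congr EFin; rewrite /f -expR_sum; congr expR.
  rewrite -mulr_sumr sumrB sumr_const card_ord /deviation -/mu -mulr_natl /t.
  by field; rewrite gt_eqF.
rewrite (iid_integral_prod iidX mf fM) lee_fin.
apply: (@le_trans _ _ (expR (8 * s ^+ 2 * t ^+ 2) ^+ n)).
  rewrite lerXn2r// ?nnegrE ?expR_ge0//; last exact: mgf_le.
  by apply: Rintegral_ge0 => x _; exact: expR_ge0.
rewrite -expRM_natl ler_expR /t le_eqVlt; apply/orP; left; apply/eqP.
by field; rewrite gt_eqF.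
Qed.
End deviation.

(** A maximum of at most exp(m) averages of n independent variables bounded by
    s is of order s sqrt(m / n). The bounding function rests on the inequality
    x <= a + exp(x - a), applied to x = l |deviation| and a = 2m, where the
    exponential of a maximum is bounded by a sum of exponentials. *)
Lemma maximal_inequality dW (W : measurableType dW) d (T : measurableType d)
    (R : realType) (P : probability W R) (Q : probability T R) (n : nat)
    (X : 'I_n -> {RV P >-> T}) (J : finType) (Y : J -> T -> R) (s m : R) :
  (0 < n)%N -> iid Q X -> (forall j, measurable_fun setT (Y j)) ->
  0 < s -> (forall j t, `|Y j t| <= s) ->
  1 <= m -> m <= n%:R -> #|J|%:R <= expR m ->
  exists B : W -> R, [/\ measurable_fun setT B, forall w, 0 <= B w,
    forall j w, `|deviation Q X (Y j) w| <= B w &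
    (\int[P]_w (B w)%:E <= (16 * s * Num.sqrt (m / n%:R))%:E)%E].
Proof.
move=> n0 iidX mY s0 Ys m1 mn cardJ.
have n0' : 0 < n%:R :> R by rewrite ltr0n.
have m0 : 0 < m by lra.
(* This value of l makes each exponential moment at most exp(m / 2); with 2
   exp(m) of them the weight exp(- 2m) brings their sum down to a constant. The
   hypothesis m <= n keeps l small enough for the quadratic bound. *)
pose l := Num.sqrt (n%:R * m) / (4 * s).
have l0 : 0 < l by rewrite divr_gt0 ?sqrtr_gt0 ?mulr_gt0.
pose dev j w := deviation Q X (Y j) w.
have mdev j : measurable_fun setT (dev j) by exact: measurable_deviation.
pose B w := l^-1 * (2 * m + expR (- (2 * m)) *
  \sum_j (expR (l * dev j w) + expR ((- l) * dev j w))).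
have mexp (a : R) j : measurable_fun setT (fun w => expR (a * dev j w)).
  by apply: measurableT_comp => //; exact: measurable_funM.
have msum : measurable_fun setT
    (fun w => \sum_j (expR (l * dev j w) + expR ((- l) * dev j w))).
  by apply: measurable_sum => j; exact: measurable_funD.
have sum0 w : 0 <= \sum_j (expR (l * dev j w) + expR ((- l) * dev j w)).
  by apply: sumr_ge0 => j _; rewrite addr_ge0 ?expR_ge0.
exists B; split.
- apply: measurable_funM => //; apply: measurable_funD => //.
  exact: measurable_funM.
- move=> w; rewrite mulr_ge0 ?invr_ge0 ?(ltW l0)// addr_ge0//; first lra.
  by rewrite mulr_ge0 ?expR_ge0.
- move=> j w; rewrite -/(dev j w) /B ler_pdivlMl//.
  apply: (@le_trans _ _ (2 * m + expR (- (2 * m)) * expR (l * `|dev j w|))).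
    rewrite -expRD -lerBlDl addrC.
    apply: le_trans (expR_ge1Dx _).
    by rewrite lerDr.
  rewrite lerD2l ler_wpM2l ?expR_ge0// (bigD1 j)//=.
  apply: (@le_trans _ _ (expR (l * dev j w) + expR (- l * dev j w))).
    have [d0|d0] := ger0P (dev j w); first by rewrite lerDl expR_ge0.
    by rewrite mulrN -mulNr lerDr expR_ge0.
  by rewrite lerDl sumr_ge0// => i _; rewrite addr_ge0 ?expR_ge0.
pose E := expR (8 * s ^+ 2 * l ^+ 2 / n%:R).
have Eh : 8 * s ^+ 2 * l ^+ 2 / n%:R = m / 2.
  rewrite /l exprMn sqr_sqrtr ?mulr_ge0// ?(ltW m0)//.
  by field; rewrite !gt_eqF.
have lle (a : R) : `|a| = l -> `|a| * (4 * s) <= n%:R.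
  move=> ->; rewrite /l divfK ?gt_eqF ?mulr_gt0//.
  rewrite -[leRHS](ger0_norm (ltW n0')) -sqrtr_sqr ler_sqrt ?sqr_ge0//.
  by rewrite expr2 ler_pM2l.
have Eexp (a : R) j : `|a| = l -> (\int[P]_w (expR (a * dev j w))%:E <= E%:E)%E.
  move=> al; have := exp_deviation_le n0 iidX (mY j) (Ys j) (lle _ al).
  by rewrite -[a ^+ 2]real_normK ?num_real// al.
have Esum : (\int[P]_w (\sum_j (expR (l * dev j w) + expR ((- l) * dev j w)))%:E
    <= (#|J|%:R * (2 * E))%:E)%E.
  under eq_integral do rewrite -sumEFin.
  have mp j : measurable_fun setT
      (fun w => (expR (l * dev j w) + expR ((- l) * dev j w))%:E).
    by apply/measurable_EFinP; exact: measurable_funD.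
  have p0 j w : setT w ->
      (0 <= (expR (l * dev j w) + expR ((- l) * dev j w))%:E)%E.
    by move=> _; rewrite lee_fin addr_ge0 ?expR_ge0.
  rewrite (ge0_integral_sum _ measurableT mp p0).
  apply: (@le_trans _ _ (\sum_(j : J) (2 * E)%:E)%E); last first.
    by rewrite sumEFin sumr_const -(mulr_natl (2 * E)).
  apply: lee_sum => j _; under eq_integral do rewrite EFinD.
  have me a : measurable_fun setT (fun w => (expR (a * dev j w))%:E).
    exact/measurable_EFinP.
  have pe a w : setT w -> (0 <= (expR (a * dev j w))%:E)%E.
    by move=> _; rewrite lee_fin expR_ge0.
  rewrite (ge0_integralD P measurableT (pe l) (me l) (pe (- l)) (me (- l))).
  rewrite (_ : 2 * E = E + E) ?EFinD; last by ring.
  by apply: leeD; apply: Eexp; rewrite ?normrN gtr0_norm.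
have -> : (\int[P]_w (B w)%:E = l^-1%:E * ((2 * m)%:E + (expR (- (2 * m)))%:E *
   \int[P]_w (\sum_j (expR (l * dev j w) + expR ((- l) * dev j w)))%:E))%E.
  under eq_integral do rewrite EFinM.
  have e0 : 0 <= expR (- (2 * m)) by exact: expR_ge0.
  have m20 : 0 <= 2 * m by lra.
  have ms : measurable_fun setT (fun w =>
      (\sum_j (expR (l * dev j w) + expR (- l * dev j w)))%:E).
    exact/measurable_EFinP.
  have ps w : setT w ->
      (0 <= (\sum_j (expR (l * dev j w) + expR (- l * dev j w)))%:E)%E.
    by move=> _; rewrite lee_fin.
  have mB : measurable_fun setT (fun w => (2 * m + expR (- (2 * m)) *
      \sum_j (expR (l * dev j w) + expR (- l * dev j w)))%:E).
    apply/measurable_EFinP; apply: measurable_funD => //.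
    exact: measurable_funM.
  have li0 : (0 <= l^-1%:E)%E by rewrite lee_fin invr_ge0 ltW.
  rewrite (ge0_integralZl P measurableT mB _ li0); last first.
    by move=> w _; rewrite lee_fin addr_ge0// mulr_ge0.
  congr (_ * _)%E; under eq_integral do rewrite EFinD (EFinM (expR _)).
  rewrite (ge0_integralD P measurableT).
  - by rewrite integral_cst_prob (ge0_integralZl P measurableT ms ps).
  - by move=> w _; rewrite lee_fin.
  - exact: measurable_cst.
  - by move=> w _; rewrite -EFinM lee_fin mulr_ge0.
  - by apply/measurable_EFinP; exact: measurable_funM.
apply: (@le_trans _ _
    (l^-1 * (2 * m + expR (- (2 * m)) * (#|J|%:R * (2 * E))))%:E).
  rewrite (EFinM l^-1) EFinD (EFinM (expR _)).
  apply: lee_wpmul2l; first by rewrite lee_fin invr_ge0 ltW.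
  by apply: leeD => //; apply: lee_wpmul2l; first by rewrite lee_fin expR_ge0.
rewrite lee_fin.
have small : expR (- (2 * m)) * (#|J|%:R * (2 * E)) <= 2 * m.
  apply: (@le_trans _ _ (expR (- (2 * m)) * (expR m * (2 * E)))).
    by rewrite ler_wpM2l ?expR_ge0// ler_wpM2r// mulr_ge0 ?expR_ge0.
  rewrite /E Eh.
  rewrite (_ : _ * _ = 2 * (expR (- (2 * m)) * expR m * expR (m / 2)));
    last by ring.
  rewrite -!expRD ler_wpM2l// (le_trans _ m1)// -[leRHS]expR0 ler_expR; lra.
apply: (@le_trans _ _ (l^-1 * (4 * m))).
  rewrite ler_wpM2l ?invr_ge0 ?(ltW l0)//; lra.
rewrite mulrC ler_pdivrMr// /l.
rewrite [leRHS](_ : _ =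
    4 * (Num.sqrt (n%:R * m) * Num.sqrt (m / n%:R))); last first.
  by field; rewrite gt_eqF.
rewrite -sqrtrM ?mulr_ge0 ?(ltW m0)//.
rewrite (_ : n%:R * m * _ = m ^+ 2); last by field; rewrite gt_eqF.
by rewrite sqrtr_sqr gtr0_norm.
Qed.

(** * Chaining *)

(** Each Z i is replaced by its approximations Z (rep k (code k i)) at the
    scales k = 0, ..., K. Between two consecutive scales the increment is of
    size 2^-k and depends only on a pair of codes, so [maximal_inequality]
    controls all of them at once; the bounding functions of the scales are
    added up. *)
Lemma chaining dW (W : measurableType dW) d (T : measurableType d)
    (R : realType) (P : probability W R) (Q : probability T R) (n : nat)
    (X : 'I_n -> {RV P >-> T}) (I : Type) (Z : I -> T -> R)
    (A : nat -> finType) (code : forall k, I -> A k) (rep : forall k, A k -> I)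
    (rho c q : R) (K : nat) :
  (0 < n)%N -> iid Q X -> 0 < rho -> 1 <= c -> 1 <= q ->
  (forall i, measurable_fun setT (Z i)) -> (forall i t, `|Z i t| <= rho) ->
  (forall k i t, `|Z (rep k (code k i)) t - Z i t| <= rho / 2 ^+ k) ->
  (forall k, #|A k|%:R <= expR (c * q ^+ k)) ->
  2 * c * q ^+ K <= n%:R ->
  exists B : W -> R, [/\ measurable_fun setT B, forall w, 0 <= B w,
    forall i w, `|deviation Q X (Z i) w| <= B w + 2 * (rho / 2 ^+ K) &
    (\int[P]_w (B w)%:E <=
      (\sum_(k < K.+1) 64 * (rho / 2 ^+ k) *
         Num.sqrt (2 * c * q ^+ k / n%:R))%:E)%E].
Proof.
move=> n0 iidX rho0 c1 q1 mZ Zrho near_rep cardA cK.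
pose pr k i := rep k (code k i).
have iZ i : Q.-integrable setT (EFin \o Z i).
  by exact: bounded_integrable (Zrho i).
have pow2_gt0 k : 0 < 2 ^+ k :> R by rewrite exprn_gt0.
have q_ge1 k : 1 <= q ^+ k by rewrite exprn_ege1.
suff [B [mB B0 BZ iB]] : exists B : W -> R,
    [/\ measurable_fun setT B, forall w, 0 <= B w,
    forall i w, `|deviation Q X (Z (pr K i)) w| <= B w &
    (\int[P]_w (B w)%:E <= (\sum_(k < K.+1) 64 * (rho / 2 ^+ k) *
       Num.sqrt (2 * c * q ^+ k / n%:R))%:E)%E].
  exists B; split=> // i w.
  rewrite -[deviation _ _ _ _](subrK (deviation Q X (Z (pr K i)) w)).
  rewrite (le_trans (ler_normD _ _))// addrC lerD// -deviationB//.
  apply: normr_deviation_le => //; first exact: measurable_funB.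
  by move=> t; rewrite distrC; exact: near_rep.
elim: K cK => [|K IH] cK.
  have [||||||B [mB B0 BZ iB]] :=
      @maximal_inequality _ _ _ _ _ P Q n X (A 0) (Z \o rep 0) rho c n0 iidX.
  - by move=> j; exact: mZ.
  - exact: rho0.
  - by move=> j t; exact: Zrho.
  - exact: c1.
  - by move: cK; rewrite expr0 mulr1; lra.
  - by have := cardA 0%N; rewrite expr0 mulr1.
  exists B; split=> //; first by move=> i w; exact: BZ.
  apply: (le_trans iB); rewrite lee_fin big_ord1 !expr0 divr1 mulr1.
  apply: ler_pM; rewrite ?sqrtr_ge0//.
  - by rewrite mulr_ge0// ltW.
  - by rewrite ler_pM2r// ler_nat.
  rewrite ler_sqrt ?divr_ge0// ?ler_wpM2r ?invr_ge0//; lra.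
have cK' : 2 * c * q ^+ K <= n%:R.
  apply: le_trans cK; rewrite exprS ler_wpM2l//; first lra.
  by rewrite ler_peMl// (le_trans ler01).
have [B [mB B0 BZ iB]] := IH cK'.
pose s := 2 * (rho / 2 ^+ K); pose m := 2 * c * q ^+ K.+1.
(* A pair of codes that does not come from one index may have functions far
   apart; it is then given the zero function. *)
pose ok (a : A K * A K.+1) :=
  `[< forall t, `|Z (rep _ a.1) t - Z (rep _ a.2) t| <= s >].
pose Y (a : A K * A K.+1) t :=
  if ok a then Z (rep _ a.2) t - Z (rep _ a.1) t else 0.
have [||||||B' [mB' B0' BZ' iB']] :=
    @maximal_inequality _ _ _ _ _ P Q n X (A K * A K.+1)%type Y s m n0 iidX.
- by move=> a; rewrite /Y; case: (ok a) => //; exact: measurable_funB.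
- by rewrite mulr_gt0// divr_gt0.
- move=> a t; rewrite /Y; case: ifPn => [/asboolP/(_ t)|_].
    by rewrite distrC.
  by rewrite normr0 mulr_ge0// divr_ge0// ltW.
- rewrite /m -[leLHS]mulr1 ler_pM//; lra.
- exact: cK.
- rewrite card_prod natrM /m.
  rewrite (_ : 2 * c * _ = c * q ^+ K.+1 + c * q ^+ K.+1); last by ring.
  rewrite expRD ler_pM// (le_trans (cardA K))// ler_expR ler_wpM2l//; first lra.
  by rewrite exprS ler_peMl// (le_trans ler01).
exists (fun w => B w + B' w); split.
- exact: measurable_funD.
- by move=> w; rewrite addr_ge0.
- move=> i w.
  have oki : ok (code K i, code K.+1 i).
    apply/asboolP => t /=; rewrite -/(pr K i) -/(pr K.+1 i).
    rewrite -[Z (pr K i) t](subrK (Z i t)) -addrA (le_trans (ler_normD _ _))//.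
    rewrite /s (_ : 2 * _ = rho / 2 ^+ K + rho / 2 ^+ K); last by ring.
    apply: lerD; first exact: near_rep.
    rewrite distrC (le_trans (near_rep _ _ _))// ler_pM2l// lef_pV2 ?posrE//.
    by rewrite ler_eXn2l// ltr1n.
  rewrite -[deviation _ _ _ _](subrK (deviation Q X (Z (pr K i)) w)).
  rewrite (le_trans (ler_normD _ _))// addrC lerD// -deviationB//.
  by have := BZ' (code K i, code K.+1 i) w; rewrite /Y oki.
under eq_integral do rewrite EFinD.
rewrite (ge0_integralD P measurableT).
- rewrite big_ord_recr/= EFinD leeD//.
  apply: (le_trans iB'); rewrite lee_fin /s /m !exprS invfM.
  rewrite le_eqVlt; apply/orP; left; apply/eqP; congr (_ * Num.sqrt _).
    by field; rewrite gt_eqF.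
- by move=> w _; rewrite lee_fin.
- exact/measurable_EFinP.
- by move=> w _; rewrite lee_fin.
- exact/measurable_EFinP.
Qed.

(** * Metric entropy of Lipschitz functions *)

(** The code of a function at scale k is the sequence of its roundings at the
    scales up to k, each encoded relatively to the previous one. The rounding
    at scale k takes the value at the centre of each cell, in units of r 2^-k;
    twice that rounding taken at the coarser centre differs from the rounding
    at scale k + 1 by an integer between -2 and 3, whatever the 1-Lipschitz
    function. Hence a bounded number of symbols per cell, and the number of
    cells grows geometrically. *)
Lemma lipschitz_code (R : realType) (T : choiceType) (dist : T -> T -> R)
    (S : set T) (x0 : T) (r : R) (D : nat)
    (cells : nat -> finType) (cell : forall k, T -> cells k) (k : nat) :
  (0 < D)%N -> 0 < r -> S x0 ->
  (forall k, #|cells k| <= 2 ^ (D * k))%N ->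
  (forall k x y, S x -> S y -> cell k x = cell k y -> dist x y <= r / 2 ^+ k) ->
  exists (A : finType) (code : (T -> R) -> A),
    (#|A| <= 8 ^ (2 * 2 ^ (D * k)))%N /\
    forall f h : T -> R, f x0 = 0 -> h x0 = 0 ->
    (forall x y, S x -> S y -> `|f x - f y| <= dist x y) ->
    (forall x y, S x -> S y -> `|h x - h y| <= dist x y) ->
    code f = code h -> forall x, S x -> `|f x - h x| <= 3 * r / 2 ^+ k.
Proof.
move=> D0 r0 Sx0 card_cells cell_dist.
have pow2_gt0 l : 0 < 2 ^+ l :> R by rewrite exprn_gt0.
pose ctr l (i : cells l) : T := xget x0 [set y | S y /\ cell l y = i].
have Sctr l i : S (ctr l i).
  by rewrite /ctr; case: xgetP => [y _ []|].
have cctr l x : S x -> cell l (ctr l (cell l x)) = cell l x.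
  move=> Sx; rewrite /ctr; case: xgetP => [y _ []//|].
  by move=> /(_ x); case.
(* At scale 0 the only centre is x0, where all the functions vanish, so that
   there is nothing to encode. *)
pose pt l x := if l is l'.+1 then ctr l (cell l x) else x0.
have Spt l x : S (pt l x) by case: l => [//|l]; exact: Sctr.
have pt_dist l x : S x -> dist x (pt l x) <= r / 2 ^+ l.
  move=> Sx; apply: cell_dist => //; case: l => [|l]; last by rewrite /= cctr.
  have := card_cells 0%N; rewrite muln0 expn0 => c1.
  apply/eqP; rewrite -[_ == _]negbK; apply/negP => ne.
  have : (#|[set cell 0%N x; cell 0%N (pt 0%N x)]%SET| <= 1)%N.
    by rewrite (leq_trans _ c1)// max_card.
  by rewrite cards2 ne.
pose lev l (f : T -> R) x : int := Num.floor (f (pt l x) * 2 ^+ l / r).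
have unscale l (u v c : R) : `|u - v| <= c * (r / 2 ^+ l) <->
    `|u * 2 ^+ l / r - v * 2 ^+ l / r| <= c.
  rewrite -!mulrA -mulrBl normrM (gtr0_norm (_ : 0 < 2 ^+ l / r)) ?divr_gt0//.
  by rewrite -ler_pdivlMr ?divr_gt0// invf_div.
suff [A [code [cA Acode]]] : exists (A : finType) (code : (T -> R) -> A),
    (#|A| <= 8 ^ (2 * 2 ^ (D * k)))%N /\
    forall f h : T -> R, f x0 = 0 -> h x0 = 0 ->
    (forall x y, S x -> S y -> `|f x - f y| <= dist x y) ->
    (forall x y, S x -> S y -> `|h x - h y| <= dist x y) ->
    code f = code h -> forall x, S x -> lev k f x = lev k h x.
  exists A, code; split => // f h f0 h0 fl hl fh x Sx.
  have := Acode f h f0 h0 fl hl fh x Sx; rewrite /lev => e.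
  have mid : `|f (pt k x) - h (pt k x)| <= 1 * (r / 2 ^+ k).
    apply/unscale; set a := f _ * _ / _; set b := h _ * _ / _.
    have /andP[] := floor_itv a; have /andP[] := floor_itv b.
    rewrite -/a -/b in e; rewrite e !intrD.
    by move: (Num.floor b)%:~R => z b1 b2 a1 a2; rewrite ler_norml; lra.
  have := le_trans (fl _ _ Sx (Spt k x)) (pt_dist k x Sx).
  have := le_trans (hl _ _ Sx (Spt k x)) (pt_dist k x Sx).
  move: mid; rewrite !ler_norml -mulrA; set u := r / 2 ^+ k; lra.
elim: k => [|k [A [code [cA Acode]]]].
  exists unit, (fun=> tt); split; first by rewrite card_unit expn_gt0.
  by move=> f h f0 h0 _ _ _ x Sx; rewrite /lev /= f0 h0.
pose step (f : T -> R) (i : cells k.+1) : int :=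
  (Num.floor (f (ctr k.+1 i) * 2 ^+ k.+1 / r) - 2 * lev k f (ctr k.+1 i))%R.
(* Shifting by 2 makes the six possible values of the step natural numbers; an
   alphabet with 8 = 2^3 letters keeps the cardinals powers of 2. *)
pose code' f := (code f, [ffun i => inord (absz (step f i + 2)) : 'I_8]).
exists (A * {ffun cells k.+1 -> 'I_8})%type, code'; split.
  rewrite card_prod card_ffun card_ord.
  apply: (@leq_trans (8 ^ (2 * 2 ^ (D * k)) * 8 ^ (2 ^ (D * k.+1)))%N).
    by rewrite leq_mul// leq_exp2l.
  have : (2 * 2 ^ (D * k) <= 2 ^ (D * k.+1))%N.
    by rewrite -expnS leq_exp2l// mulnS addnC -addn1 leq_add2l.
  rewrite -expnD leq_exp2l//; lia.
move=> f h f0 h0 fl hl [fh step_fh] x Sx.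
have step_bnd g : (forall x y, S x -> S y -> `|g x - g y| <= dist x y) ->
    forall i, (-2 <= step g i <= 3)%R.
  move=> gl i; rewrite /step /lev.
  set y := ctr k.+1 i; have Sy : S y by exact: Sctr.
  have := le_trans (gl _ _ Sy (Spt k y)) (pt_dist k y Sy).
  rewrite -[r / _]mul1r => /unscale.
  set a := g y * _ / _; set b := g (pt k y) * _ / _.
  rewrite (_ : g y * 2 ^+ k.+1 / r = 2 * a); last by rewrite /a exprS; ring.
  rewrite ler_norml => /andP[ab1 ab2].
  have /andP[] := floor_itv (2 * a); have /andP[] := floor_itv b.
  rewrite !intrD => b1 b2 a1 a2.
  have H1 : (- 3)%:~R < (Num.floor (2 * a) - 2 * Num.floor b)%:~R :> R.
    rewrite intrB intrM; lra.
  have H2 : (Num.floor (2 * a) - 2 * Num.floor b)%:~R < 4%:~R :> R.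
    rewrite intrB intrM; lra.
  by move: H1 H2; rewrite !ltr_int; lia.
have step_eq i : step f i = step h i.
  have /(congr1 (fun u : {ffun cells k.+1 -> 'I_8} => val (u i))) := step_fh.
  have := step_bnd f fl i; have := step_bnd h hl i.
  rewrite !ffunE /=; move: (step f i) (step h i) => a b.
  have lt8 (z : int) : (-2 <= z <= 3)%R -> (absz (z + 2)%R < 8)%N by lia.
  move=> /[dup] /lt8 b8 hb /[dup] /lt8 a8 hf; rewrite !inordK//; lia.
have := step_eq (cell k.+1 x); rewrite /step.
by rewrite (Acode f h f0 h0 fl hl fh _ (Sctr _ _)) => /addIr.
Qed.

(** The cell of x in the partition of the cube ]-L, L[^d into 2^(dk) cubes. The
    bound is written as a successor because [inord] asks for one. *)
Definition grid_cell (R : realType) (T : Type) (d k : nat) (L : R)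
    (coord : 'I_d -> T -> R) (x : T) : {ffun 'I_d -> 'I_(2 ^ k).-1.+1} :=
  [ffun i => inord (Num.truncn ((coord i x + L) / (2 * L) * 2 ^+ k))].

Lemma card_grid_cell d k : #|{ffun 'I_d -> 'I_(2 ^ k).-1.+1}| = (2 ^ (d * k))%N.
Proof. by rewrite card_ffun !card_ord prednK ?expn_gt0// -expnM mulnC. Qed.

Lemma grid_cell_dist (R : realType) (T : Type) (d k : nat) (L : R)
    (coord : 'I_d -> T -> R) (x y : T) (i : 'I_d) :
  0 < L -> `|coord i x| < L -> `|coord i y| < L ->
  grid_cell k L coord x = grid_cell k L coord y ->
  `|coord i x - coord i y| <= 2 * L / 2 ^+ k.
Proof.
move=> L0 cx cy.
move=> /(congr1 (fun u : {ffun 'I_d -> 'I_(2 ^ k).-1.+1} => val (u i))).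
have p2 : 0 < 2 ^+ k :> R by rewrite exprn_gt0.
have L2 : 0 < 2 * L by lra.
have scaled z : `|coord i z| < L ->
    0 <= (coord i z + L) / (2 * L) * 2 ^+ k < 2 ^+ k.
  rewrite ltr_norml => /andP[z1 z2]; apply/andP; split.
    by rewrite mulr_ge0 ?divr_ge0 ?ltW// -ltrBlDr sub0r.
  rewrite -[ltRHS]mul1r ltr_pM2r// ltr_pdivrMr// mul1r.
  by rewrite mulr_natl mulr2n ltrD2r.
have tr z : `|coord i z| < L ->
    (Num.truncn ((coord i z + L) / (2 * L) * 2 ^+ k) < (2 ^ k).-1.+1)%N.
  move=> /scaled /andP[z1 z2]; rewrite prednK ?expn_gt0//.
  by rewrite -(ltr_nat R) natrX (le_lt_trans _ z2)// truncn_le.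
rewrite !ffunE /= !inordK ?tr// => e.
have /andP[x1 x2] := scaled x cx; have /andP[y1 y2] := scaled y cy.
have /andP[x3 x4] := truncn_itv x1; have /andP[y3 y4] := truncn_itv y1.
rewrite e in x3 x4.
have : `|(coord i x + L) / (2 * L) * 2 ^+ k -
         (coord i y + L) / (2 * L) * 2 ^+ k| <= 1.
  move: x3 x4 y3 y4; rewrite -(@natr1 _ (Num.truncn _)).
  by move: ((Num.truncn _)%:R) => t; rewrite ler_norml; lra.
rewrite (_ : _ - _ = (coord i x - coord i y) / (2 * L / 2 ^+ k)); last first.
  by field; rewrite !gt_eqF.
rewrite normrM (gtr0_norm (_ : 0 < (2 * L / 2 ^+ k)^-1)) ?invr_gt0 ?divr_gt0//.
by rewrite ler_pdivrMr ?divr_gt0// mul1r.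
Qed.

(** * The choice of the finest scale *)

Lemma sum_geom_incr (R : realFieldType) (x : R) K : 4 / 3 <= x ->
  \sum_(k < K.+1) x ^+ k <= 4 * x ^+ K.
Proof.
move=> x1; elim: K => [|K IH]; first by rewrite big_ord1 expr0; lra.
rewrite big_ord_recr/= (le_trans (lerD IH (lexx _)))//.
have : 0 <= x ^+ K by rewrite exprn_ge0//; lra.
rewrite exprS; move: (x ^+ K) => y; nra.
Qed.

Lemma sum_geom_decr (R : realFieldType) (x : R) K : 0 <= x <= 3 / 4 ->
  \sum_(k < K.+1) x ^+ k <= 4.
Proof.
move=> /andP[x0 x1]; apply: (@le_trans _ _ (4 - 3 * x ^+ K)); last first.
  have : 0 <= x ^+ K by rewrite exprn_ge0.
  lra.
elim: K => [|K IH]; first by rewrite big_ord1 expr0; lra.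
rewrite big_ord_recr/= (le_trans (lerD IH (lexx _)))//.
have : 0 <= x ^+ K by rewrite exprn_ge0//; lra.
rewrite exprS; move: (x ^+ K) => y; nra.
Qed.

Lemma ln2_ge (R : realType) : 1 / 2 <= ln 2 :> R.
Proof.
rewrite -ler_expR lnK ?posrE//; have := expR_ge1Dx (- (1 / 2) : R).
rewrite expRN => h.
rewrite -[leLHS]invrK -[leRHS]invrK lef_pV2 ?posrE ?invr_gt0 ?expR_gt0//.
lra.
Qed.

(** K is the largest integer with 24 * 2^(dK) <= n, where 24 is twice the
    constant 12 of [lip_pair_codes], as required by [chaining]. Then 2^-K is of
    order n^(-1/d), and the sum over the scales is a geometric sum of ratio
    2^(d/2) / 2, which decreases, is constant, or grows according to d. *)
Lemma rate_bound (R : realType) (d n : nat) (rho : R) :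
  (0 < d)%N -> 0 < rho -> (24 <= n)%N ->
  exists K, 24 * (2 ^+ d) ^+ K <= n%:R :> R /\
  \sum_(k < K.+1) 64 * (rho / 2 ^+ k) * Num.sqrt (24 * (2 ^+ d) ^+ k / n%:R)
    + 2 * (rho / 2 ^+ K) <= 100 * 200 * rho * rate R d n.
Proof.
move=> d0 rho0 n24.
have n0 : 0 < n%:R :> R by rewrite ltr0n (leq_trans _ n24).
have n1 : 1 <= n%:R :> R by rewrite ler1n (leq_trans _ n24).
have p1 : (1 < 2 ^ d)%N by rewrite -{1}(expn0 2) ltn_exp2l.
have m0 : (0 < n %/ 24)%N by rewrite divn_gt0.
pose K := trunc_log (2 ^ d) (n %/ 24); exists K.
have /andP[Kle Klt] := trunc_log_bounds p1 m0; rewrite -/K in Kle Klt.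
have Kn : 24 * (2 ^+ d) ^+ K <= n%:R :> R.
  rewrite -!natrX -natrM ler_nat (leq_trans (leq_mul (leqnn 24) Kle))//.
  by rewrite mulnC leq_divM.
(* By maximality of K, n < 24 * 2^(d (K + 1)), and 24 <= 24^d. *)
have nK : n%:R <= (48 * 2 ^+ K) ^+ d :> R.
  have : (n < 24 * (2 ^ d) ^ K.+1)%N.
    by rewrite mulnC -ltn_divLR.
  move=> /ltnW; rewrite -(ler_nat R) natrM !natrX => /le_trans; apply.
  rewrite exprMn exprS -(exprM 2 K) mulnC exprM mulrA.
  rewrite (_ : 48 = 24 * 2) ?exprMn; last by rewrite -natrM.
  rewrite ler_pM2r ?exprn_gt0// ler_pM2r ?exprn_gt0//.
  by rewrite ler_eXnr// ?ler1n.
split=> //.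
have pow2 k : 0 < 2 ^+ k :> R by rewrite exprn_gt0.
have tail : (2 ^+ K)^-1 <= 48 * n%:R `^ (- (1 / d%:R)) :> R.
  rewrite powRN ler_pdivlMr ?powR_gt0// mulrC ler_pdivrMr//.
  have c0 : 0 <= 48 * 2 ^+ K :> R by rewrite mulr_ge0// ltW.
  have -> : 48 * 2 ^+ K = ((48 * 2 ^+ K) ^+ d) `^ (1 / d%:R) :> R.
    rewrite -(powR_mulrn d c0) -powRrM mul1r.
    by rewrite mulfV ?pnatr_eq0 -?lt0n// powRr1.
  by rewrite ge0_ler_powR// ?nnegrE ?ltW// ?exprn_gt0 ?mulr_gt0// divr_ge0.
pose kap : R := Num.sqrt (2 ^+ d).
have kap0 : 0 <= kap by rewrite sqrtr_ge0.
have sE k : Num.sqrt (24 * (2 ^+ d) ^+ k / n%:R) =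
    Num.sqrt (24 / n%:R) * kap ^+ k.
  rewrite mulrAC sqrtrM ?divr_ge0// ?(ltW n0)//; congr (_ * _).
  elim: k => [|k IH]; first by rewrite !expr0 sqrtr1.
  by rewrite !exprS sqrtrM ?exprn_ge0// IH.
(* The k-th term is a constant times (sqrt(2^d) / 2)^k. *)
have -> : \sum_(k < K.+1) 64 * (rho / 2 ^+ k) *
      Num.sqrt (24 * (2 ^+ d) ^+ k / n%:R) =
    64 * rho * Num.sqrt (24 / n%:R) * \sum_(k < K.+1) (kap / 2) ^+ k.
  rewrite mulr_sumr; apply: eq_bigr => k _; rewrite sE expr_div_n.
  rewrite -!mulrA; congr (_ * (_ * _)).
  by rewrite mulrCA; congr (_ * _); rewrite mulrC.
have sqrt24 : Num.sqrt (24 / n%:R) <= 5 * n%:R `^ (- (1 / 2)) :> R.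
  rewrite powRN mul1r powR12_sqrt ?(ltW n0)// sqrtrM// sqrtrV ?(ltW n0)//.
  rewrite ler_wpM2r ?invr_ge0 ?sqrtr_ge0//.
  rewrite -(ler_pXn2r (_ : (0 < 2)%N)) ?nnegrE ?sqrtr_ge0// sqr_sqrtr//; lra.
have s0 : 0 <= Num.sqrt (24 / n%:R) :> R by rewrite sqrtr_ge0.
set S := \sum_(k < _) _.
have S0 : 0 <= S by apply: sumr_ge0 => k _; rewrite exprn_ge0// divr_ge0.
have h0 : 0 < n%:R `^ (- (1 / 2)) :> R by rewrite powR_gt0.
rewrite /rate; case: ifPn => [/eqP d1|d1].
  have S4 : S <= 4.
    apply: sum_geom_decr; rewrite divr_ge0//= ler_pdivrMr//.
    have c0 : 0 <= 3 / 4 * 2 :> R by lra.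
    rewrite -(ler_pXn2r (_ : (0 < 2)%N)) ?nnegrE ?sqrtr_ge0//.
    rewrite sqr_sqrtr ?exprn_ge0// d1; lra.
  have tl : (2 ^+ K)^-1 <= 48 * n%:R `^ (- (1 / 2)) :> R.
    apply: (le_trans tail); rewrite ler_pM2l// d1.
    rewrite !powRN lef_pV2 ?posrE ?powR_gt0//.
    by rewrite ler_powR//; lra.
  move: h0 sqrt24 tl; set h := n%:R `^ _; set s := Num.sqrt _.
  set t := _^-1 => h0 sh th.
  have -> : 2 * (rho / 2 ^+ K) = rho * (2 * t) by rewrite /t; ring.
  rewrite (_ : 64 * rho * s * S = rho * (64 * (s * S))); last by ring.
  rewrite -mulrDr (_ : 100 * 200 * rho * h = rho * (100 * 200 * h));
    last by ring.
  rewrite ler_pM2l//.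
  have sS : s * S <= 5 * h * 4 by rewrite ler_pM.
  lra.
case: ifPn => [/eqP d2|d2].
  have kapE : kap / 2 = 1.
    by rewrite /kap d2 sqrtr_sqr ger0_norm// divff.
  have SE : S = K.+1%:R.
    rewrite /S kapE; under eq_bigr do rewrite expr1n.
    by rewrite sumr_const card_ord.
  have lnK : K%:R <= ln n%:R :> R.
    have : ln (4 ^+ K) <= ln n%:R :> R.
      rewrite ler_ln ?posrE ?exprn_gt0//; apply: le_trans Kn.
      rewrite d2 (_ : 2 ^+ 2 = 4); last by ring.
      by rewrite ler_peMl// ?exprn_ge0//; lra.
    rewrite lnXn// (_ : 4 = 2 * 2) ?lnM ?posrE//; last by ring.
    move/(le_trans _); apply.
    rewrite -[leRHS]mulr_natl -[leLHS]mulr1 ler_wpM2l//.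
    have := ln2_ge R; lra.
  have ln1 : 1 <= ln n%:R :> R.
    have : ln (2 * 2) <= ln n%:R :> R.
      by rewrite ler_ln ?posrE// -natrM ler_nat (leq_trans _ n24).
    rewrite lnM ?posrE//; have := ln2_ge R; lra.
  have tl : (2 ^+ K)^-1 <= 48 * n%:R `^ (- (1 / 2)) :> R by rewrite d2 in tail.
  rewrite SE -(@natr1 _ K).
  move: h0 sqrt24 tl ln1 lnK; set l := ln _; set h := n%:R `^ _.
  set s := Num.sqrt _; set t := _^-1 => h0 sh th l1 lK.
  have -> : 2 * (rho / 2 ^+ K) = rho * (2 * t) by rewrite /t; ring.
  rewrite (_ : 64 * rho * s * _ = rho * (64 * (s * (K%:R + 1)))); last by ring.
  rewrite -mulrDr (_ : 100 * 200 * rho * _ = rho * (100 * 200 * (h * l)));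
    last by ring.
  rewrite ler_pM2l//.
  have sS : s * (K%:R + 1) <= 5 * h * (2 * l) by rewrite ler_pM//; lra.
  have hl : h <= h * l by rewrite ler_peMr// ltW.
  lra.
have d3 : (3 <= d)%N by case: (d) d0 d1 d2 => [|[|[|]]].
have S4 : S <= 4 * (kap / 2) ^+ K.
  apply: sum_geom_incr; rewrite ler_pdivlMr//.
  rewrite -(ler_pXn2r (_ : (0 < 2)%N)) ?nnegrE ?sqrtr_ge0//.
  rewrite sqr_sqrtr ?exprn_ge0//; apply: (@le_trans _ _ (2 ^+ 3)); first by lra.
  by rewrite ler_eXn2l// ltr1n.
have sk : Num.sqrt (24 / n%:R) * kap ^+ K <= 1.
  rewrite -sE -[leRHS]sqrtr1 ler_sqrt// ler_pdivrMr// mul1r//.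
have sS : Num.sqrt (24 / n%:R) * S <= 4 * (2 ^+ K)^-1.
  apply: (@le_trans _ _ (4 * (Num.sqrt (24 / n%:R) * kap ^+ K) * (2 ^+ K)^-1)).
    apply: le_trans (ler_wpM2l s0 S4) _; rewrite expr_div_n le_eqVlt.
    by apply/orP; left; apply/eqP; ring.
  by rewrite ler_wpM2r ?invr_ge0 ?(ltW (pow2 K))// -[leRHS]mulr1 ler_wpM2l.
move: tail sS; set h := n%:R `^ (- (1 / d%:R)).
set s := Num.sqrt _; set t := _^-1 => th sS.
have -> : 2 * (rho / 2 ^+ K) = rho * (2 * t) by rewrite /t; ring.
rewrite (_ : 64 * rho * s * S = rho * (64 * (s * S))); last by ring.
rewrite -mulrDr (_ : 100 * 200 * rho * h = rho * (100 * 200 * h)); last by ring.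
have : 0 < h by rewrite powR_gt0.
rewrite ler_pM2l//; lra.
Qed.

(** * Means of Lipschitz functions as functions of the random probability *)

Lemma continuous_borel_measurable (R : realType) (T : ptopologicalType)
    (f : T -> R) :
  continuous f -> measurable_fun [set: borel T] (f : borel T -> R).
Proof.
move=> cf.
apply: (measurability (@RGenOpens.G R)) => [|/= _ [_] [x [y ->]] <-].
  exact: RGenOpens.measurableE.
rewrite setTI; apply: sub_sigma_algebra.
by apply: (open_comp (fun x _ => cf x)); exact: interval_open.
Qed.

(** The weak topology is the coarsest one with this property. *)
Lemma continuous_mean (R : realType) (T : ptopologicalType) (f : T -> R) :
  continuous f -> bounded_fun f -> continuous (mean f : Prob R T -> R).
Proof.
move=> cf bf P A nA.
pose i : Cb R T := exist _ f (conj cf bf).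
pose Tc (f : Cb R T) := Topological.on (initial_topology (mean (sval f))).
have H := (@cvg_sup (Prob R T) (Cb R T) Tc (nbhs P) P _).1 (@cvg_id _ _) i.
apply: H.
exact: (@initial_continuous _ _ (mean f : Prob R T -> R) P A nA).
Qed.

Section lipschitz_means.
Variables (R : realType) (M : pmetricType R) (D : R).
Hypothesis mdist_le : forall x y : M, mdist x y <= D.

Lemma lip1_continuous (f : M -> R) : lip1 f -> continuous f.
Proof.
move=> fl x; apply/cvgrPdist_lt => e e0; near=> y.
apply: le_lt_trans (fl _ _) _.
have : ball x e y by near: y; exact: nbhsx_ballx.
by rewrite ballEmdist.
Unshelve. all: by end_near. Qed.

Lemma lip1_bounded (f : M -> R) : lip1 f -> bounded_fun f.
Proof.
move=> fl; exists (`|f point| + D); split; first exact: num_real.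
move=> x Mx t _ /=; rewrite (le_trans _ (ltW Mx))//.
rewrite -[f t](subrK (f point)) (le_trans (ler_normD _ _))// addrC lerD2l.
exact: le_trans (fl _ _) _.
Qed.

Lemma lip1_measurable (f : M -> R) : lip1 f ->
  measurable_fun [set: borel M] (f : borel M -> R).
Proof. by move/lip1_continuous; exact: continuous_borel_measurable. Qed.

Lemma lip1_integrable (f : M -> R) (P : Prob R M) : lip1 f ->
  (P : probability (borel M) R).-integrable setT (EFin \o f).
Proof.
move=> fl.
apply: (@bounded_integrable _ _ _ _ (f : borel M -> R) (`|f point| + D)).
  exact: lip1_measurable.
move=> t; rewrite -[f t](subrK (f point)) (le_trans (ler_normD _ _))//.
by rewrite addrC lerD2l (le_trans (fl _ _)).
Qed.

Lemma measurable_mean (f : M -> R) : lip1 f ->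
  measurable_fun [set: borel (Prob R M)] (mean f : borel (Prob R M) -> R).
Proof.
move=> fl; apply: continuous_borel_measurable; apply: continuous_mean.
  exact: lip1_continuous.
exact: lip1_bounded.
Qed.

Lemma normr_mean_le (f : M -> R) (P : Prob R M) s : lip1 f ->
  (forall x, `|f x| <= s) -> `|mean f P| <= s.
Proof.
by move=> fl fs; apply: normr_Rintegral_le => //; exact: lip1_measurable.
Qed.

Lemma dist_mean_le (f h : M -> R) (P : Prob R M) s : lip1 f -> lip1 h ->
  (forall x, `|f x - h x| <= s) -> `|mean f P - mean h P| <= s.
Proof.
move=> fl hl fhs; rewrite /mean -RintegralB//; last 2 first.
- exact: lip1_integrable.
- exact: lip1_integrable.
apply: normr_Rintegral_le => //.
by apply: measurable_funB; exact: lip1_measurable.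
Qed.

Lemma mean_subr (f : M -> R) (P : Prob R M) c : lip1 f ->
  mean (fun x => f x - c) P = mean f P - c.
Proof.
move=> fl; rewrite /mean RintegralB//; last 2 first.
- exact: lip1_integrable.
- exact: (@bounded_integrable _ _ _ _ _ `|c|).
by rewrite Rintegral_cst_prob.
Qed.

End lipschitz_means.

(** Sums of measures are compatible with the integral of nonnegative functions,
    hence the shift by the bound s. *)
Lemma Rintegral_empirical d (T : measurableType d) (R : realType) (n : nat)
    (n0 : (0 < n)%N) (x : 'I_n -> T) (h : T -> R) (s : R) :
  measurable_fun setT h -> (forall t, `|h t| <= s) ->
  (\int[empirical R n0 x]_t h t)%R = n%:R^-1 * \sum_i h (x i).
Proof.
move=> mh hs.
pose x' k : {measure set T -> \bar R} :=
  dirac (if insub k is Some i then x i else point).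
have nv : 0 <= n%:R^-1 :> R by [].
pose mu := mscale (NngNum nv) (msum x' n) : {measure set T -> \bar R}.
have nn0 : n%:R != 0 :> R by rewrite pnatr_eq0 -lt0n.
have ihs : (\int[empirical R n0 x]_t (h t + s)%:E =
    (n%:R^-1 * \sum_i (h (x i) + s))%:E)%E.
  have hs0 t : 0 <= h t + s.
    by have := hs t; rewrite ler_norml => /andP[]; lra.
  have mhs : measurable_fun setT (fun t => (h t + s)%:E).
    by apply/measurable_EFinP; exact: measurable_funD.
  transitivity (\int[mu]_t (h t + s)%:E)%E.
    apply: eq_measure_integral => A mA _.
    rewrite /empirical /mu /mscale /msum/=; congr (_ * _)%E.
    by apply: eq_bigr => i _; rewrite /x' valK.
  rewrite ge0_integral_mscale//; last by move=> t _; rewrite lee_fin.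
  rewrite ge0_integral_measure_sum//; last by move=> t _; rewrite lee_fin.
  rewrite EFinM -sumEFin; congr (_ * _)%E; apply: eq_bigr => i _.
  by rewrite /x' integral_dirac// diracT mul1e valK.
have ih : (empirical R n0 x).-integrable setT (EFin \o h).
  exact: bounded_integrable hs.
have is_ : (empirical R n0 x).-integrable setT (EFin \o (fun=> s)).
  exact: (@bounded_integrable _ _ _ _ _ `|s|).
have := RintegralD measurableT ih is_; rewrite Rintegral_cst_prob.
rewrite {1}/Rintegral ihs /= big_split/= sumr_const card_ord -[s *+ n]mulr_natl.
by rewrite mulrDr mulKf// => /addIr.
Qed.

(** * Pairs of Lipschitz functions *)

(** The metric space is described by coordinates: it has diameter at most D,
    its points lie in the open cube of half-side L, and points with close
    coordinates are close. *)
Section lipschitz_pairs.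
Variables (R : realType) (M : pmetricType R) (d : nat) (D L : R) (x0 : M).
Variable coord : 'I_d -> M -> R.
Hypotheses (d0 : (0 < d)%N) (D0 : 0 <= D) (DL : D < L).
Hypothesis mdist_le : forall x y : M, mdist x y <= D.
Hypothesis coord_lt : forall i x, `|coord i x| < L.
Hypothesis mdist_coord : forall (x y : M) c, 0 <= c ->
  (forall i, `|coord i x - coord i y| <= c) -> mdist x y <= d%:R * c.

(** The index set of the empirical process: the test functions on probability
    measures have the form P |-> g(P(f)) for f = inner and g = outer. *)
Record lip_pair := LipPair {
  inner : M -> R ; outer : R -> R ;
  inner_lip : lip1 inner ; inner0 : inner x0 = 0 ;
  outer_lip : lipR outer ; outer0 : outer 0 = 0 }.

Definition pair_test (i : lip_pair) (P : borel (Prob R M)) : R :=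
  outer i (mean (inner i) P).

Let L0 : 0 < L. Proof. exact: le_lt_trans DL. Qed.

(** A grid cell of scale k has diameter at most cell_scale / 2^k, both in M
    and, for the arguments of the outer functions, in [-L, L]. *)
Definition cell_scale : R := d%:R * (2 * L).

Let scale_gt0 : 0 < cell_scale.
Proof. by rewrite mulr_gt0 ?ltr0n ?mulr_gt0. Qed.

Let scale_ge : 2 * L <= cell_scale.
Proof. by rewrite ler_peMl ?mulr_ge0 ?(ltW L0)// ler1n. Qed.

Lemma normr_inner_le i x : `|inner i x| <= D.
Proof.
by rewrite -[inner i x]subr0 -(inner0 i) (le_trans (inner_lip i _ _)).
Qed.

Lemma normr_mean_inner_le i P : `|mean (inner i) P| <= D.
Proof.
by apply: normr_mean_le; [exact: inner_lip|exact: normr_inner_le].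
Qed.

Lemma measurable_pair_test i : measurable_fun setT (pair_test i).
Proof.
apply: (measurableT_comp (lipR_measurable (@outer_lip i))).
by apply: measurable_mean (@inner_lip i); exact: mdist_le.
Qed.

Lemma normr_pair_test_le i P : `|pair_test i P| <= 6 * cell_scale.
Proof.
rewrite -[pair_test i P]subr0 -(outer0 i) (le_trans (outer_lip i _ _))// subr0.
rewrite (le_trans (normr_mean_inner_le i P))//.
have := scale_ge; have := ltW L0; have := ltW DL; lra.
Qed.

Definition zero_pair : lip_pair.
Proof.
apply: (@LipPair (fun=> 0) (fun=> 0)) => // x y; rewrite subrr normr0//.
exact: mdist_ge0.
Defined.

(** The two codes are put together, and each code in the range is given a pair
    with that code as its representative. Two test functions differ by at most
    the distance of the inner functions plus the distance of the outer
    functions on [-D, D], where all the means lie. Set, code map and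
    representatives form one existential package, to be chosen for every k at
    once. *)
Lemma lip_pair_codes k :
  exists p : {A : finType & ((lip_pair -> A) * (A -> lip_pair))%type},
  (#|projT1 p|%:R <= expR (12 * (2 ^+ d) ^+ k) :> R) /\
  forall i P, `|pair_test ((projT2 p).2 ((projT2 p).1 i)) P - pair_test i P|
    <= 6 * cell_scale / 2 ^+ k.
Proof.
pose cell1 l := grid_cell l L coord.
pose cell2 l := grid_cell l L (fun (_ : 'I_1) (x : R) => x).
have [||A1 [code1 [cA1 H1]]] :=
  @lipschitz_code R M (@mdist R M) setT x0 cell_scale d
    (fun l => {ffun 'I_d -> 'I_(2 ^ l).-1.+1}) cell1 k d0 scale_gt0 I _ _.
- by move=> l; rewrite card_grid_cell.
- move=> l x y _ _ e; rewrite /cell_scale -mulrA.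
  have p2 : 0 < 2 ^+ l :> R by rewrite exprn_gt0.
  apply: mdist_coord; first by rewrite divr_ge0 ?mulr_ge0// ltW.
  by move=> i; exact: grid_cell_dist e.
have [|||A2 [code2 [cA2 H2]]] := @lipschitz_code R R (fun x y => `|x - y|)
    [set x | `|x| <= D] 0 cell_scale 1
    (fun l => {ffun 'I_1 -> 'I_(2 ^ l).-1.+1}) cell2 k isT scale_gt0 _ _ _.
- by rewrite /= normr0.
- by move=> l; rewrite card_grid_cell.
- move=> l x y /= xD yD e.
  have p2 : 0 < 2 ^+ l :> R by rewrite exprn_gt0.
  apply: (@le_trans _ _ (2 * L / 2 ^+ l)).
    exact: (@grid_cell_dist _ _ _ _ _ (fun=> id) x y ord0 L0
      (le_lt_trans xD DL) (le_lt_trans yD DL) e).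
  by rewrite ler_pM2r ?invr_gt0.
pose code i := (code1 (inner i), code2 (outer i)).
pose rep a :=
  if pselect (exists i, code i = a) is left h then sval (cid h) else zero_pair.
exists (existT (fun A : finType => ((lip_pair -> A) * (A -> lip_pair))%type)
  (A1 * A2)%type (code, rep)); split=> /=.
  rewrite card_prod.
  apply: (@le_trans _ _ (8 ^+ (4 * 2 ^ (d * k)))).
    rewrite -natrX ler_nat (leq_trans (leq_mul cA1 cA2))// -expnD leq_exp2l//.
    rewrite (_ : (4 = 2 + 2)%N)// mulnDl leq_add2l leq_mul2l/= leq_exp2l//.
    by rewrite leq_mul2r d0 orbT.
  (* Both codes together have at most 8^(4 * 2^(dk)) values; hence 12 = 3 * 4.
     *)
  have e8 : 8 <= expR 3 :> R.
    apply: (@le_trans _ _ (2 ^+ 3)); first by lra.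
    rewrite -[3 in leRHS]mulr1 expRM_natl lerXn2r ?nnegrE ?expR_ge0//.
    by have := expR_ge1Dx (1 : R).
  apply: (@le_trans _ _ (expR 3 ^+ (4 * 2 ^ (d * k)))).
    by rewrite lerXn2r ?nnegrE ?expR_ge0.
  rewrite -expRM_natl ler_expR natrM natrX exprM.
  by rewrite le_eqVlt; apply/orP; left; apply/eqP; ring.
move=> i P; set j := rep (code i).
have [e1 e2] : code j = code i.
  rewrite /j /rep; case: pselect => [h|[]]; first by case: cid.
  by exists i.
rewrite /pair_test.
have h1 x : `|inner j x - inner i x| <= 3 * cell_scale / 2 ^+ k.
  apply: H1 => //; [exact: inner0|exact: inner0|..].
  - by move=> ? ? _ _; exact: inner_lip.
  - by move=> ? ? _ _; exact: inner_lip.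
have h2 x : `|x| <= D -> `|outer j x - outer i x| <= 3 * cell_scale / 2 ^+ k.
  apply: H2 => //; [exact: outer0|exact: outer0|..].
  - by move=> ? ? _ _; exact: outer_lip.
  - by move=> ? ? _ _; exact: outer_lip.
set u := mean (inner j) P; set v := mean (inner i) P.
rewrite (_ : outer j u - outer i v =
  (outer j u - outer j v) + (outer j v - outer i v)); last by ring.
rewrite (le_trans (ler_normD _ _))//.
rewrite (_ : 6 * _ / _ = 3 * cell_scale / 2 ^+ k + 3 * cell_scale / 2 ^+ k);
  last by ring.
apply: lerD; last by apply: h2; exact: normr_mean_inner_le.
rewrite (le_trans (outer_lip j _ _))//.
by apply: (dist_mean_le mdist_le) => //; exact: inner_lip.
Qed.

End lipschitz_pairs.

(** * The Lipschitz distance to the empirical measure *)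

Lemma dLip_ge0 (R : realType) (M : pmetricType R) (Q1 Q2 : Prob R (Prob R M)) :
  (0 <= dLip Q1 Q2)%E.
Proof.
apply: (@le_trans _ _ (wasserstein
    (pushforward (Q1 : probability (borel (Prob R M)) R) (mean (fun=> 0)))
    (pushforward (Q2 : probability (borel (Prob R M)) R) (mean (fun=> 0))))).
  apply: le_ereal_inf_tmp => _ [g _ <-].
  by apply: integral_ge0 => z _; rewrite lee_fin.
apply: ereal_sup_ubound; exists (fun=> 0) => // x y.
by rewrite subrr normr0; exact: mdist_ge0.
Qed.

(** Duality for the two laws of the mean of f reduces the distance to the
    values of the empirical process at the pairs (f, g); subtracting f(x0) from
    f, and translating g accordingly, gives a pair that vanishes at the base
    points and changes both integrals by the same constant. *)
Lemma dLip_empirical_le (R : realType) (M : pmetricType R) (D : R) (x0 : M)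
    (Q : Prob R (Prob R M)) (n : nat) (n0 : (0 < n)%N)
    (P : 'I_n -> borel (Prob R M)) (b : R) :
  (forall x y : M, mdist x y <= D) ->
  (forall i : lip_pair x0, `|n%:R^-1 * \sum_j pair_test i (P j) -
      \int[(Q : probability (borel (Prob R M)) R)]_p pair_test i p| <= b) ->
  (dLip (empirical R n0 P) Q <= b%:E)%E.
Proof.
move=> mdist_le H; apply: ge_ereal_sup => _ [f fl <-].
have mf := measurable_mean mdist_le fl.
pose E : probability (borel (Prob R M)) R := empirical R n0 P.
pose Q' : probability (borel (Prob R M)) R := Q.
pose X : {RV E >-> R} := HB.pack (mean f : borel (Prob R M) -> R)
  (isMeasurableFun.Build _ _ _ _ _ mf).
pose Y : {RV Q' >-> R} := HB.pack (mean f : borel (Prob R M) -> R)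
  (isMeasurableFun.Build _ _ _ _ _ mf).
have fb x : `|f x| <= `|f x0| + D.
  rewrite -[f x](subrK (f x0)) (le_trans (ler_normD _ _))// addrC lerD2l.
  exact: le_trans (fl _ _) _.
have mb p : `|mean f p| <= `|f x0| + D by exact: normr_mean_le.
suff : (wasserstein (pushforward E X) (pushforward Q' Y) <= b%:E)%E by [].
apply: (wasserstein_le_dual (X := X) (Y := Y) mb mb) => g gl /=.
have fl' : lip1 (fun x => f x - f x0).
  by move=> x y; rewrite opprB addrA subrK; exact: fl.
have gl' : lipR (fun y => g (y + f x0) - g (f x0)).
  move=> y z; rewrite opprB addrA subrK (le_trans (gl _ _))//.
  by rewrite opprD addrACA subrr addr0.
have f0' : f x0 - f x0 = 0 by rewrite subrr.
have g0' : g (0 + f x0) - g (f x0) = 0 by rewrite add0r subrr.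
pose i : lip_pair x0 := LipPair fl' f0' gl' g0'.
have testE p : pair_test i p = g (mean f p) - g (f x0).
  by rewrite /pair_test /= (mean_subr mdist_le)// subrK.
have mg : measurable_fun setT (g \o (mean f : borel (Prob R M) -> R)).
  exact: measurableT_comp (lipR_measurable gl) mf.
have gb p : `|g (mean f p)| <= `|g 0| + (`|f x0| + D).
  rewrite -[g _](subrK (g 0)) (le_trans (ler_normD _ _))// addrC lerD2l.
  by rewrite (le_trans (gl _ _))// subr0.
have ig : Q'.-integrable setT (EFin \o (g \o mean f)).
  exact: (bounded_integrable Q' mg gb).
have eQ : (\int[Q']_p pair_test i p = \int[Q']_p g (mean f p) - g (f x0))%R.
  have ic : Q'.-integrable setT (EFin \o (fun=> g (f x0))).
    exact: (@bounded_integrable _ _ _ _ _ `|g (f x0)|).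
  rewrite -[in RHS](Rintegral_cst_prob Q' (g (f x0))).
  rewrite -(RintegralB measurableT ig ic).
  by apply: eq_Rintegral => p _; exact: testE.
have eE : n%:R^-1 * \sum_j pair_test i (P j) =
    (\int[E]_p g (mean f p))%R - g (f x0).
  rewrite (Rintegral_empirical n0 P mg gb) (eq_bigr _ (fun j _ => testE (P j))).
  rewrite sumrB sumr_const card_ord -[g (f x0) *+ n]mulr_natl mulrBr mulKf//.
  by rewrite pnatr_eq0 -lt0n.
have Hi := H i.
have {Hi} : `|n%:R^-1 * \sum_j pair_test i (P j) - \int[Q']_p pair_test i p| <=
  b.
  exact: Hi.
rewrite eQ eE opprB addrA subrK; exact: le_trans (ler_norm _).
Qed.

Theorem theorem4p3 (R : realType) (d : nat) (D : R) (d_gt0 : (0 < d)%N) :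
  exists C : R, 0 < C /\
    forall (X : set (euclidean R d)) (X0 : X !=set0),
      metric_bounded X -> polish (metric_subset X0) -> diam X = D ->
    forall Q : Prob R (Prob R (metric_subset X0)),
    exists N : nat, forall (n : nat) (n_gt0 : (0 < n)%N), (N <= n)%N ->
    forall (dW : measure_display) (W : measurableType dW) (P : probability W R)
      (Pt : 'I_n -> {RV P >-> borel (Prob R (metric_subset X0))}),
      iid Q Pt ->
      (\int[P]_w dLip (empirical R n_gt0 (Pt ^~ w)) Q <= (C * rate R d n)%:E)%E.
Proof.
(* L is chosen strictly above the diameter, so that the points have coordinates
   in the open cube and the cells have positive size even if X is a point. *)
pose L : R := `|D| + 1.
have DL : D < L by rewrite (le_lt_trans (ler_norm _))// ltrDl.
have L0 : 0 < L by rewrite ltr_wpDl.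
pose rho := 6 * cell_scale d L.
have rho0 : 0 < rho by rewrite !mulr_gt0 ?ltr0n.
have const_gt0 : 0 < 100 * 200 :> R by lra.
exists (100 * 200 * rho); split; first exact: mulr_gt0.
move=> X X0 [b Xb] _ diamX Q; exists 24 => n n0 n24 dW W P Pt iidP.
pose M := metric_subset X0.
have mdist_le (x y : M) : mdist x y <= D.
  rewrite -diamX; apply: ub_le_sup.
    by exists b => _ [x' [y' [Xx Xy ->]]]; exact: Xb.
  by exists (val x), (val y); split => //; exact/set_mem/valP.
pose x0 : M := point.
have D0 : 0 <= D by rewrite -(mdistxx x0).
pose coord (i : 'I_d) (x : M) : R :=
  (val x : 'rV[R]_d) ord0 i - (val x0 : 'rV[R]_d) ord0 i.
(* The diameter bounds the coordinates relative to x0; conversely the Euclidean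
   norm is at most d times the largest coordinate. *)
have coord_le i (x : M) : `|coord i x| <= mdist x x0.
  rewrite -sqrtr_sqr ler_wsqrtr// (bigD1 i)//= lerDl.
  by apply: sumr_ge0 => j _; exact: sqr_ge0.
have coord_lt i (x : M) : `|coord i x| < L.
  by rewrite (le_lt_trans (coord_le i x))// (le_lt_trans (mdist_le _ _)).
have mdist_coord (x y : M) c : 0 <= c ->
    (forall i, `|coord i x - coord i y| <= c) -> mdist x y <= d%:R * c.
  move=> c0 H; rewrite -[leRHS]ger0_norm ?mulr_ge0// -sqrtr_sqr ler_wsqrtr//.
  apply: (@le_trans _ _ (\sum_(i < d) c ^+ 2)).
    apply: ler_sum => i _; rewrite -[leLHS]real_normK ?num_real//.
    rewrite lerXn2r ?nnegrE//; have := H i; rewrite /coord.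
    by rewrite opprB addrA subrK.
  rewrite sumr_const card_ord -[leLHS]mulr_natl exprMn ler_wpM2r ?sqr_ge0//.
  by rewrite expr2 ler_peMl// ler1n.
have codes k := cid (@lip_pair_codes R M d D L x0 coord d_gt0 D0 DL mdist_le
  coord_lt mdist_coord k).
pose A k := projT1 (sval (codes k)).
pose code k := (projT2 (sval (codes k))).1.
pose rep k := (projT2 (sval (codes k))).2.
have [K [Kn rateK]] := rate_bound d_gt0 rho0 n24.
have [|||||||B [mB B0 BZ iB]] := @chaining _ W _ (borel (Prob R M)) R P Q n Pt
  (lip_pair x0) (@pair_test R M x0) A code rep rho 12 (2 ^+ d) K n0 iidP rho0.
- lra.
- by rewrite exprn_ege1// ler1n.
- by move=> i; exact: measurable_pair_test mdist_le i.
- exact: (normr_pair_test_le d_gt0 D0 DL mdist_le).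
- by move=> k i p; exact: (svalP (codes k)).2.
- by move=> k; exact: (svalP (codes k)).1.
- by rewrite (_ : 2 * 12 = 24) //; ring.
apply: (@le_trans _ _ (\int[P]_w (B w + 2 * (rho / 2 ^+ K))%:E)%E).
  apply: ge0_le_integral_nonmeasurable => w; first exact: dLip_ge0.
  by apply: dLip_empirical_le mdist_le _ => i; exact: BZ.
under eq_integral do rewrite EFinD.
rewrite ge0_integralD//; last 3 first.
- by move=> w _; rewrite lee_fin.
- exact/measurable_EFinP.
- by move=> w _; rewrite lee_fin mulr_ge0// divr_ge0// ltW.
rewrite integral_cst_prob (le_trans (leeD iB (lexx _)))//.
rewrite -EFinD lee_fin; apply: le_trans rateK.
by rewrite (_ : 2 * 12 = 24)//; ring.
Qed.
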